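(* Let $(X,\mathbb{Z}^k,T)$ be a dynamical system with the marker property and $\mathrm{mdim}(X)=0$. Then the set of continuous functions $f:X\to\mathbb{R}$ satisfying $\mathrm{ocap}(\{x\in X: f(x)=0\})=0$ is a dense $G_\delta$ subset of $C(X)$.
   Context: $C(X)$ is the Banach space of real continuous functions with the sup norm. Orbit capacity of $A\subset X$: $\mathrm{ocap}(A)=\lim_{N\to\infty}N^{-k}\sup_{x\in X}\sum_{n\in[N]}1_A(T^nx)$, $[N]=\{0,\dots,N-1\}^k$. Marker property: for every finite $F\subset\mathbb{Z}^k$ there is an open $U$ with $X=\bigcup_nT^nU$ and $U\cap T^nU=\emptyset$ for nonzero $n\in F$. Mean dimension: with $d_\Omega(x,y)=\sup_{n\in\Omega}d(T^nx,T^ny)$, $\mathrm{widim}_\varepsilon(X,d)$ the minimal dimension of a finite simplicial complex admitting a continuous map whose fibers have $d$-diameter $<\varepsilon$, $\mathrm{mdim}(X)=\lim_{\varepsilon\to0}\lim_{N\to\infty}N^{-k}\mathrm{widim}_\varepsilon(X,d_{[N]})$. *)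

(* Defs.v *)
From HB Require Import structures.
From mathcomp Require Import all_boot all_order all_algebra.
From mathcomp Require Import all_classical all_reals all_analysis.
Set Implicit Arguments. Unset Strict Implicit. Unset Printing Implicit Defensive.
Import Order.TTheory GRing.Theory Num.Theory.
Import numFieldNormedType.Exports.
Local Open Scope ring_scope.
Definition simplicial_complex (n : nat) (S : {set {set 'I_n}}) : Prop :=
  (@finset.set0 _) \notin S /\
  (forall s t, s \in S -> t != (@finset.set0 _) -> t \subset s -> t \in S).

Definition sc_dim (n : nat) (S : {set {set 'I_n}}) : nat :=
  \max_(s in S) #|s|.-1.

Definition realization (R : realType) (n : nat) (S : {set {set 'I_n}})
  : classical_sets.set 'rV[R]_n :=
  fun t => (forall i, 0 <= t ord0 i) /\ \sum_i t ord0 i = 1 /\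
           [set i | t ord0 i != 0] \in S.

Local Open Scope classical_set_scope.
Local Open Scope ring_scope.

Definition ivec (k N : nat) (v : 'rV['I_N]_k) : 'rV[int]_k :=
  map_mx (fun i : 'I_N => ((i : nat) : int)) v.

Definition is_Zk_action (k : nat) (X : topologicalType)
    (T : 'rV[int]_k -> X -> X) : Prop :=
  (forall x, T 0 x = x) /\
  (forall m n x, T (m + n) x = T m (T n x)) /\
  (forall n, continuous (T n)).

Definition is_metric_for (R : realType) (X : topologicalType)
    (d : X -> X -> R) : Prop :=
  (forall x y, 0 <= d x y) /\
  (forall x y, d x y = 0 <-> x = y) /\
  (forall x y, d x y = d y x) /\
  (forall x y z, d x z <= d x y + d y z) /\
  (forall A : set X, open A <->
     (forall x, A x -> exists2 e : R, 0 < e & [set y | d x y < e] `<=` A)).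

Definition marker_property (k : nat) (X : topologicalType)
    (T : 'rV[int]_k -> X -> X) : Prop :=
  forall F : seq 'rV[int]_k, exists U : set X,
    open U /\
    (\bigcup_(n in [set: 'rV[int]_k]) (T n @` U) = [set: X]) /\
    (forall n, n \in F -> n != 0 -> U `&` (T n @` U) = set0).

Definition bowen (R : realType) (k : nat) (X : Type)
    (T : 'rV[int]_k -> X -> X) (d : X -> X -> R) (N : nat) (x y : X) : R :=
  \big[Num.max/0]_(v : 'rV['I_N]_k) d (T (ivec v) x) (T (ivec v) y).

Definition orbit_count (R : realType) (k : nat) (X : Type)
    (T : 'rV[int]_k -> X -> X) (A : set X) (N : nat) (x : X) : R :=
  \sum_(v : 'rV['I_N]_k) ((T (ivec v) x \in A) : nat)%:R.

Definition ocap_is (R : realType) (k : nat) (X : Type)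
    (T : 'rV[int]_k -> X -> X) (A : set X) (c : R) : Prop :=
  (fun N : nat => (N%:R ^+ k)^-1 * sup (range (orbit_count R T A N))) @ \oo --> c.

Definition eps_embeds (R : realType) (X : topologicalType) (d : X -> X -> R)
    (e : R) (m : nat) : Prop :=
  exists n (S : {set {set 'I_n}}) (F : X -> 'rV[R]_n),
    [/\ simplicial_complex S, sc_dim S = m, continuous F,
        (forall x, realization S (F x)) &
        (forall t, exists2 r, r < e &
            forall x y, F x = t -> F y = t -> d x y <= r)].

Definition widim (R : realType) (X : topologicalType) (d : X -> X -> R)
    (e : R) : R :=
  inf [set (m%:R : R) | m in [set m | eps_embeds d e m]].

Definition mdim_is (R : realType) (k : nat) (X : topologicalType)
    (T : 'rV[int]_k -> X -> X) (d : X -> X -> R) (c : R) : Prop :=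
  exists g : R -> R,
    (forall e, 0 < e ->
       (fun N : nat => (N%:R ^+ k)^-1 * widim (bowen T d N) e) @ \oo --> g e) /\
    (g e @[e --> 0^'+] --> c).

Definition supdist (R : realType) (X : Type) (f g : X -> R) : R :=
  sup (range (fun x => `|f x - g x|)).

(* Open subsets of C(X) (sup norm topology); sets are sets of functions,
   only their continuous members matter. *)
Definition C_open (R : realType) (X : topologicalType) (O : set (X -> R)) :=
  forall f, continuous f -> O f ->
    exists2 e : R, 0 < e & forall g, continuous g -> supdist f g < e -> O g.

Definition C_dense (R : realType) (X : topologicalType) (G : set (X -> R)) :=
  forall f, continuous f -> forall e : R, 0 < e ->
    exists g, [/\ continuous g, G g & supdist f g < e].

Definition C_Gdelta (R : realType) (X : topologicalType) (G : set (X -> R)) :=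
  exists O : nat -> set (X -> R),
    (forall m, C_open (O m)) /\
    (forall f, continuous f -> (G f <-> forall m, O m f)).

(* Main.v *)
Require Import Defs.
From HB Require Import structures.
From mathcomp Require Import all_boot all_order all_algebra.
From mathcomp Require Import all_classical all_reals all_analysis.
From mathcomp Require Import zify ring lra.
Import Order.TTheory GRing.Theory Num.Theory.
Import numFieldNormedType.Exports.
Local Open Scope classical_set_scope.
Local Open Scope ring_scope.
Set Implicit Arguments.
Unset Strict Implicit.

(** Zero sets of small orbit density form an open condition on [f], and the
    density is subadditive along cubes, so the theorem reduces to Baire's
    argument plus one perturbation step: any continuous [f] is uniformly close
    to some [g] whose zeros have small density on one large cube.

    Zero mean dimension provides a cube [[N]] and a map [F] of [X] into a complex
    of dimension [m <= eta N^k] with [d_[N]]-small fibers. The functions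
    [f (T^j x)], [j] in [[N]], are approximated by functions that are Lipschitz
    in [F x] (McShane extension); since an [m]-dimensional complex is covered by
    [O(Q^m)] cells of size [1/Q], a pigeonhole count over constants on a finite
    grid makes at most [m] of the shifted functions vanish at any given point.

    To glue these blocks, each orbit is tiled by the power diagram of its marker
    points: [p] belongs to the tile of the site [n] minimizing [|p - n|^2 + H n].
    If [n] minimizes [lam |z - n|^2 + H n] with [lam = 1 - 1/q], then shrinking
    [z] towards [n] by the factor [lam] lands deep inside the tile of [n].
    Rounded to the lattice this shrinking is injective off a set of proportion
    [k/q], so most positions are deep in their tiles. In the interior of a
    tile [g] is given by the blocks, with at most [m] zeros on each cube of
    [N^k] positions; elsewhere it interpolates with [f]. *)

(** * Power diagrams on the integer lattice *)

Lemma normr_int_nat (R : realType) (z : int) : `|z%:~R| = `|z|%N%:R :> R.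
Proof. by rewrite natr_absz intr_norm. Qed.

Definition sqnorm (R : realType) (k : nat) (v : 'rV[int]_k) : R :=
  \sum_i (v ord0 i)%:~R ^+ 2.

Definition in_box (k K : nat) (v : 'rV[int]_k) : Prop :=
  forall i, (`|v ord0 i| <= K)%N.

Section PowerDiagram.
Variables (R : realType) (k : nat).
Implicit Types (H : 'rV[int]_k -> R) (m n p z v : 'rV[int]_k).

(** The slack 1 is what lets tiles be blended continuously: in [glue] a cost gap of at least 1 is
    clamped to exactly 1. *)
Definition beats H p n m : Prop :=
  sqnorm R (p - n) + H n + 1 <= sqnorm R (p - m) + H m.

Lemma sqnorm_ge0 v : 0 <= sqnorm R v :> R.
Proof. by apply: sumr_ge0 => i _; exact: sqr_ge0. Qed.

Lemma sqnorm_box K v : in_box K v -> sqnorm R v <= k%:R * K%:R ^+ 2 :> R.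
Proof.
move=> vK; rewrite mulr_natl -[X in _ *+ X]card_ord -sumr_const.
apply: ler_sum => i _.
rewrite -real_normK ?num_real// lerXn2r ?nnegrE//.
by rewrite normr_int_nat ler_nat.
Qed.

(** Compare the cost differences at [p] and at [z]. With [w = m - n] and [b] the error of [p]
    against the exact shrinking, a coordinate contributes [w^2/q - 2 b w], since [1 - lam = 1/q].
    Completing the square bounds this below by [w^2/(2q) - 2 q A^2], and one coordinate with
    [|w| > L] pays for all errors and for the slack. *)
Lemma shrink_gap H (q L : nat) (A : R) z n m p : (0 < q)%N ->
  let lam : R := 1 - q%:R^-1 in
  lam * sqnorm R (z - n) + H n <= lam * sqnorm R (z - m) + H m ->
  (forall i, `|(p ord0 i - n ord0 i)%:~R - lam * (z ord0 i - n ord0 i)%:~R| <= A) ->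
  (exists i, (L < `|m ord0 i - n ord0 i|)%N) ->
  2 * q%:R * (1 + 2 * k%:R * q%:R * A ^+ 2) <= L%:R ^+ 2 ->
  beats H p n m.
Proof.
move=> q0 lam Hmin HA [i0 Hi0] HL; rewrite /beats.
have q0R : 0 < q%:R :> R by rewrite ltr0n.
have E1 : sqnorm R (p - m) - sqnorm R (p - n) =
   \sum_i ((m ord0 i - n ord0 i)%:~R ^+ 2
     - 2 * (p ord0 i - n ord0 i)%:~R * (m ord0 i - n ord0 i)%:~R) :> R.
  rewrite /sqnorm -sumrB; apply: eq_bigr => i _; rewrite !mxE !intrD !intrN; ring.
have E2 : lam * sqnorm R (z - m) - lam * sqnorm R (z - n) =
   \sum_i (lam * ((m ord0 i - n ord0 i)%:~R ^+ 2
     - 2 * (z ord0 i - n ord0 i)%:~R * (m ord0 i - n ord0 i)%:~R)) :> R.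
  rewrite -mulrBr /sqnorm -sumrB mulr_sumr; apply: eq_bigr => i _.
  rewrite !mxE !intrD !intrN; ring.
suff : 1 <= (sqnorm R (p - m) - sqnorm R (p - n)) -
    (lam * sqnorm R (z - m) - lam * sqnorm R (z - n)) by lra.
rewrite E1 E2 -sumrB.
set t := (X in \sum_i X i).
have tge i : (m ord0 i - n ord0 i)%:~R ^+ 2 / (2 * q%:R) - 2 * q%:R * A ^+ 2 <= t i.
  rewrite /t; have := HA i.
  set w := (m ord0 i - n ord0 i)%:~R; set a := (z ord0 i - n ord0 i)%:~R.
  set b := _ - lam * a => Hb.
  have -> : (p ord0 i - n ord0 i)%:~R = b + lam * a by rewrite /b; ring.
  have -> : w ^+ 2 - 2 * (b + lam * a) * w - lam * (w ^+ 2 - 2 * a * w)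
     = w ^+ 2 / q%:R - 2 * b * w by rewrite /lam; ring.
  have bA : b ^+ 2 <= A ^+ 2.
    by rewrite -[leLHS]real_normK ?num_real// lerXn2r ?nnegrE// (le_trans _ Hb).
  have : 0 <= (w - 2 * q%:R * b) ^+ 2 / (2 * q%:R).
    by apply: divr_ge0; rewrite ?sqr_ge0// mulr_ge0// ltW.
  have -> : (w - 2 * q%:R * b) ^+ 2 / (2 * q%:R) =
     w ^+ 2 / (2 * q%:R) - 2 * b * w + 2 * q%:R * b ^+ 2.
    by field; rewrite gt_eqF.
  have : q%:R * b ^+ 2 <= q%:R * A ^+ 2 by rewrite ler_pM2l.
  have -> : w ^+ 2 / q%:R = 2 * (w ^+ 2 / (2 * q%:R)) by field; rewrite gt_eqF.
  lra.
apply: (@le_trans _ _ (\sum_i ((m ord0 i - n ord0 i)%:~R ^+ 2 / (2 * q%:R)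
    - 2 * q%:R * A ^+ 2))); last first.
  by apply: ler_sum => i _; exact: tge.
rewrite sumrB sumr_const card_ord -[X in _ - X]mulr_natl.
apply: (@le_trans _ _ (L%:R ^+ 2 / (2 * q%:R) - k%:R * (2 * q%:R * A ^+ 2))).
  rewrite lerBrDr ler_pdivlMr; last by rewrite mulr_gt0.
  by apply: le_trans HL; rewrite le_eqVlt; apply/orP; left; apply/eqP; ring.
rewrite lerD2r (bigD1 i0)//= -[leLHS]addr0; apply: lerD.
  apply: ler_wpM2r; first by rewrite invr_ge0 mulr_ge0 ?ltW.
  rewrite -[leRHS]real_normK ?num_real// lerXn2r ?nnegrE//.
  by rewrite normr_int_nat ler_nat ltnW.
by apply: sumr_ge0 => i _; rewrite divr_ge0 ?sqr_ge0// mulr_ge0 ?ltW.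
Qed.

End PowerDiagram.

(** A lattice version of [u - u/q]. As [u] grows by 1 the value grows by 1, except that it stalls
    when [u + t] reaches a multiple of [q]; the free offset [t] moves these collisions. *)
Definition shr (q t : nat) (u : int) : int := u - ((u + t%:Z) %/ q%:Z)%Z.

Section Shrink.
Variables (q t : nat).
Hypotheses (q1 : (1 < q)%N) (tq : (t < q)%N).

Lemma shr_floor u : exists f : int,
  [/\ shr q t u = u - f, f * q%:Z <= u + t%:Z & u + t%:Z < f * q%:Z + q%:Z].
Proof.
exists ((u + t%:Z) %/ q%:Z)%Z; split=> //; first by apply: lez_floor; lia.
by have := @ltz_ceil (u + t%:Z) q%:Z; rewrite mulrDl mul1r; apply; lia.
Qed.

Lemma shr_le u : (`|shr q t u| <= `|u|)%N /\ (`|u - shr q t u| <= `|u|)%N.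
Proof.
have [f [-> f1 f2]] := shr_floor u.
have [u0|u0] := lerP 0 u.
- have : 0 <= f by nia.
  have : f <= u by nia.
  by lia.
- have : f <= 0 by nia.
  have : u <= f by nia.
  by lia.
Qed.

Lemma shr_near (R : realType) (u : int) :
  `|(shr q t u)%:~R - (1 - q%:R^-1) * u%:~R| <= 1 :> R.
Proof.
have [f [-> f1 f2]] := shr_floor u.
have q0 : 0 < q%:R :> R by rewrite ltr0n; lia.
have g1 : f%:~R * q%:R <= u%:~R + t%:R :> R.
  by rewrite -(ler_int R) in f1; rewrite !(intrM, intrD) in f1.
have g2 : u%:~R + t%:R < f%:~R * q%:R + q%:R :> R.
  by rewrite -(ltr_int R) in f2; rewrite !(intrM, intrD) in f2.
have t0 : 0 <= t%:R :> R by [].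
have tqR : t%:R < q%:R :> R by rewrite ltr_nat.
rewrite intrB -(ler_pM2l q0) -{1}(gtr0_norm q0) -normrM.
have -> : q%:R * (u%:~R - f%:~R - (1 - q%:R^-1) * u%:~R) = u%:~R - f%:~R * q%:R :> R.
  by field; rewrite gt_eqF.
by rewrite ler_norml; apply/andP; split; lra.
Qed.

Lemma shr_inj (u u' : int) : ~~ (q%:Z %| u + t%:Z)%Z -> ~~ (q%:Z %| u' + t%:Z)%Z ->
  shr q t u = shr q t u' -> u = u'.
Proof.
have q0 : (q%:Z != 0) by lia.
rewrite /shr !(sameP dvdz_mod0P eqP).
have := divz_eq (u + t%:Z) q%:Z; have := divz_eq (u' + t%:Z) q%:Z.
have := modz_ge0 (u + t%:Z) q0; have := modz_ge0 (u' + t%:Z) q0.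
have := @ltz_pmod (u + t%:Z) q%:Z ltac:(lia).
have := @ltz_pmod (u' + t%:Z) q%:Z ltac:(lia).
set r := modz (u + _) _; set r' := modz (u' + _) _.
set a := divz (u + _) _; set b := divz (u' + _) _ => ? ? ? ? E' E r0 r0' ab.
(* Both remainders lie between 1 and [q - 1], so the right side is smaller than [q - 1] in absolute
   value and the quotients agree. *)
have h : (a - b) * (q%:Z - 1) = r' - r.
  have : u - u' = a - b by lia.
  have : u - u' = (a - b) * q%:Z + r - r' by rewrite mulrBl; lia.
  by move=> -> ?; rewrite mulrBr mulr1; lia.
move: r0 r0' => /eqP r0 /eqP r0'.
have [lab|lab|lab] := ltrgtP a b; [|  |lia]; exfalso.
- have : (a - b) * (q%:Z - 1) <= - (q%:Z - 1) by nia.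
  lia.
- have : (a - b) * (q%:Z - 1) >= (q%:Z - 1) by nia.
  lia.
Qed.

End Shrink.

(** Averaging over [t]: a pair [(w, i)] is hit by at most one [t] below [q], so all [q] offsets
    together produce at most [k * #|W|] bad points. *)
Lemma exists_offset (q k : nat) (W : finType) (u : W -> 'I_k -> int) : (0 < q)%N ->
  exists2 t, (t < q)%N &
    (q * #|[pred w | [exists i, (q%:Z %| (u w i + t%:Z)%R)%Z]]| <= k * #|W|)%N.
Proof.
move=> q0; apply: contrapT => /forall2NP H.
pose hit (t : 'I_q) := [pred w | [exists i, (q%:Z %| (u w i + (t : nat)%:Z)%R)%Z]].
have {}H (t : 'I_q) : (k * #|W| < q * #|hit t|)%N.
  by have [//|/negP] := H t; rewrite -ltnNge.
have : (\sum_(t < q) (k * #|W|).+1 <= \sum_(t < q) q * #|hit t|)%N.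
  by apply: leq_sum => t _; exact: H.
rewrite sum_nat_const card_ord -big_distrr/= leq_pmul2l// ltnNge => /negP; apply.
apply: (@leq_trans (\sum_(t < q) \sum_(w : W) \sum_(i < k) (q%:Z %| (u w i + (t : nat)%:Z)%R)%Z)%N).
  apply: leq_sum => t _; rewrite -sum1_card big_mkcond /=.
  apply: leq_sum => w _; rewrite inE; case: ifP => // /existsP[i ui].
  by rewrite (bigD1 i)//= ui.
rewrite exchange_big /=.
apply: (@leq_trans (\sum_(w : W) \sum_(i < k) 1)%N); last first.
  by rewrite !sum_nat_const card_ord muln1 mulnC.
apply: leq_sum => w _; rewrite exchange_big/=; apply: leq_sum => i _.
have -> : (\sum_(t < q) (q%:Z %| (u w i + (t : nat)%:Z)%R)%Z =
    #|[pred t : 'I_q | (q%:Z %| (u w i + (t : nat)%:Z)%R)%Z]|)%N.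
  by rewrite -sum1_card [RHS]big_mkcond; apply: eq_bigr => t _; rewrite inE; case: ifP.
apply/card_le1_eqP => t t'; rewrite !inE => /dvdzP[a Ha] /dvdzP[b Hb]; apply/val_inj => /=.
have := ltn_ord t; have := ltn_ord t'.
have : (t : nat)%:Z - (t' : nat)%:Z = (a - b) * q%:Z by rewrite mulrBl -Ha -Hb; lia.
have [ab|ab|ab] := ltrgtP a b; [|  | by move: ab => ->; lia].
- have : (a - b) * q%:Z <= - q%:Z by nia.
  lia.
- have : (a - b) * q%:Z >= q%:Z by nia.
  lia.
Qed.

(** Recentring makes a finite type enumerate the box of radius [K], so that minima, sums and
    products over nearby sites are finite operations. *)
Definition bvec (k K : nat) (v : 'rV['I_(K.*2).+1]_k) : 'rV[int]_k :=
  \row_i ((v ord0 i : nat)%:Z - K%:Z).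

Lemma in_box_bvec (k K : nat) (n : 'rV[int]_k) :
  in_box K n -> exists v : 'rV['I_(K.*2).+1]_k, bvec v = n.
Proof.
move=> nK; exists (\row_i inord `|(n ord0 i + K%:Z)%R|%N).
apply/rowP => i; rewrite !mxE; have := nK i; set u := n _ _ => ui.
rewrite inordK; last by lia.
by lia.
Qed.

Lemma bvec_in_box (k K : nat) (v : 'rV['I_(K.*2).+1]_k) : in_box K (bvec v).
Proof. by move=> i; rewrite mxE; have := ltn_ord (v ord0 i); lia. Qed.

Lemma exists_ivec (k M : nat) (n : 'rV[int]_k) :
  (forall i, 0 <= n ord0 i < M%:Z) -> exists v : 'rV['I_M]_k, ivec v = n.
Proof.
move=> nM; have nM' i : (`|n ord0 i| < M)%N by have := nM i; lia.
exists (\row_i Ordinal (nM' i)); apply/rowP => i; rewrite !mxE /=.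
by have := nM i; set u := n _ _; lia.
Qed.

Lemma ivec_inj (k M : nat) : injective (@ivec k M).
Proof.
move=> v w vw; apply/rowP => i; apply/val_inj => /=.
by have := congr1 (fun u : 'rV[int]_k => u ord0 i) vw; rewrite !mxE => -[].
Qed.

Lemma leq_absz_shift (a b c s : int) (r N : nat) :
  (`|s| <= `|(a - b)%R|)%N -> (`|c| <= N)%N -> (`|(a - b)%R| <= r)%N ->
  (`|(b + s + c - b)%R| <= r + N)%N.
Proof. lia. Qed.

Lemma shift_in_window (b s : int) (w r N M : nat) : (w < M)%N ->
  (`|((w + (r + N))%N%:Z - b - s)%R| <= `|((w + (r + N))%N%:Z - b)%R|)%N ->
  (`|((w + (r + N))%N%:Z - b)%R| <= r)%N ->
  N%:Z <= b + s < (M + r.*2 + N)%N%:Z.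
Proof. lia. Qed.

(** * Most lattice points lie deep in a tile *)

Section Tiling.
Variables (R : realType) (k : nat) (H : 'rV[int]_k -> R) (q N L D : nat) (B : R).
Let reach := (k.+1 * D)%N.
Hypotheses (q1 : (1 < q)%N)
  (H0 : forall m, 0 <= H m <= B)
  (Hsite : forall z, exists2 m, in_box D (z - m) & H m = 0)
  (Hsep : forall n m, m != n -> H n < B -> H m < B ->
     exists i, (L < `|m ord0 i - n ord0 i|)%N)
  (HL : 2 * q%:R * (1 + 2 * k%:R * q%:R * (N.+1)%:R ^+ 2) <= L%:R ^+ 2 :> R)
  (HB : k%:R * D%:R ^+ 2 + k%:R * (reach + N)%:R ^+ 2 + 1 <= B).

Let lam : R := 1 - q%:R^-1.

Lemma lam_in01 : 0 <= lam <= 1.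
Proof.
have q0 : 0 < q%:R :> R by rewrite ltr0n; lia.
have : q%:R^-1 <= 1 :> R by rewrite invf_le1// ler1n; lia.
have : 0 <= q%:R^-1 :> R by rewrite invr_ge0 ltW.
by rewrite /lam; lra.
Qed.

Definition minimizer z n := [/\ in_box reach (z - n), H n <= k%:R * D%:R ^+ 2 &
  forall m, lam * sqnorm R (z - n) + H n <= lam * sqnorm R (z - m) + H m].

(** A site of height 0 within [D] costs at most [lam k D^2], while a site outside the box of radius
    [reach = (k+1) D] costs more through its distance alone. Hence a minimum over this finite box is
    global. *)
Lemma exists_minimizer z : exists n, minimizer z n.
Proof.
have [m0 m0D Hm0] := Hsite z.
have m0r : in_box reach (z - m0).
  by move=> i; apply: leq_trans (m0D i) _; rewrite /reach leq_pmull.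
have [v0 v0E] := in_box_bvec m0r.
pose F (v : 'rV['I_(reach.*2).+1]_k) := lam * sqnorm R (bvec v) + H (z - bvec v).
have [l0 l1] := andP lam_in01.
case: (@Order.TotalTheory.arg_minP _ _ _ v0 xpredT F erefl) => v _ vmin.
have zv : z - (z - bvec v) = bvec v by rewrite subKr.
have low : F v <= lam * (k%:R * D%:R ^+ 2).
  apply: (le_trans (vmin v0 isT)).
  rewrite /F v0E subKr Hm0 addr0 ler_wpM2l//.
  exact: sqnorm_box.
have Dge : 0 <= k%:R * D%:R ^+ 2 :> R by rewrite mulr_ge0 ?exprn_ge0.
exists (z - bvec v); split.
- by rewrite zv; exact: bvec_in_box.
- have : F v <= k%:R * D%:R ^+ 2 by apply: (le_trans low); rewrite ler_piMl.
  apply: le_trans; rewrite /F lerDr mulr_ge0//; exact: sqnorm_ge0.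
- move=> m; rewrite zv.
  have [mr|] := pselect (in_box reach (z - m)).
    have [w wE] := in_box_bvec mr.
    by have := vmin w isT; rewrite /F wE subKr.
  move=> /existsNP[i /negP]; rewrite -ltnNge => Hi.
  apply: (le_trans low).
  have [Hm _] := andP (H0 m).
  rewrite -[leLHS]addr0 lerD// ler_wpM2l//.
  apply: (@le_trans _ _ (reach%:R ^+ 2)).
    rewrite /reach natrM exprMn ler_wpM2r ?exprn_ge0// -natrX ler_nat.
    by nia.
  rewrite /sqnorm (bigD1 i)//= -[leLHS]addr0 lerD//.
    rewrite -[leRHS]real_normK ?num_real// lerXn2r ?nnegrE//.
    by rewrite normr_int_nat ler_nat ltnW.
  by apply: sumr_ge0 => j _; exact: sqr_ge0.
Qed.

Definition shrink t (z n : 'rV[int]_k) : 'rV[int]_k :=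
  \row_i (n ord0 i + shr q t (z ord0 i - n ord0 i)).

Lemma row_subE (z n : 'rV[int]_k) i : (z - n) ord0 i = z ord0 i - n ord0 i.
Proof. by rewrite !mxE. Qed.

Lemma shrink_subE t (z n : 'rV[int]_k) i :
  (shrink t z n - n) ord0 i = shr q t (z ord0 i - n ord0 i).
Proof. by rewrite !mxE addrAC subrr add0r. Qed.

(** Competitors of height below [B] are farther than [L] and lose by [shrink_gap] with error
    [N + 1]: [N] for [e], 1 for the rounding. The others lose by height alone, as [HB] puts [B]
    above the cost of [n] at the shrunken point plus the slack. *)
Lemma shrink_deep t z n e m : (t < q)%N -> minimizer z n -> in_box N e -> m != n ->
  beats H (shrink t z n + e) n m.
Proof.
move=> tq [zn Hn nmin] eN mn.
have HnB : H n < B.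
  apply: (le_lt_trans Hn); apply: lt_le_trans HB.
  by rewrite -addrA ltrDl ltr_wpDl// mulr_ge0// exprn_ge0.
have [HmB|HmB] := ltP (H m) B.
- apply: (@shrink_gap _ _ H q L (N.+1)%:R z) => //; first exact: ltnW.
  + move=> i; rewrite !mxE.
    have -> : n ord0 i + shr q t (z ord0 i - n ord0 i) + e ord0 i - n ord0 i =
      shr q t (z ord0 i - n ord0 i) + e ord0 i by ring.
    rewrite intrD addrAC -natr1 addrC.
    apply: (le_trans (ler_normD _ _)); rewrite lerD//.
      by rewrite normr_int_nat ler_nat.
    exact: shr_near.
  + exact: Hsep.
- rewrite /beats.
  have : sqnorm R (shrink t z n + e - n) <= k%:R * (reach + N)%:R ^+ 2.
    apply: sqnorm_box => i; rewrite !mxE.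
    have := zn i; have := eN i; rewrite !mxE.
    have [+ _] := shr_le q1 tq (z ord0 i - n ord0 i).
    exact: leq_absz_shift.
  have := sqnorm_ge0 R (shrink t z n + e - m).
  move: HB HmB Hn; move: (sqnorm _ _) (sqnorm _ _) (_ * _ ^+ 2) (_ * _ ^+ 2) (H _) (H _).
  move=> u v a b x y. lra.
Qed.

Lemma beats_asym p n m : beats H p n m -> beats H p m n -> False.
Proof. by rewrite /beats; lra. Qed.

(** [Z] is the shrunken image of a cube of side [M0] in the middle of the window. Shrinking moves a
    point by at most [reach], which leaves a margin [N] on every side. A good offset discards a
    proportion at most [k/q] of the positions, and shrinking is injective on the rest. *)
Lemma deep_count M0 : let M := (M0 + (reach + N).*2)%N in
  exists Z : {set 'rV['I_M]_k},
    (q * M0 ^ k <= q * #|Z| + k * M0 ^ k)%N /\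
    forall v, v \in Z ->
      (forall i, (N <= v ord0 i)%N && (v ord0 i + N < M)%N) /\
      exists2 n, in_box reach (ivec v - n) &
        forall e, in_box N e -> forall m, m != n -> beats H (ivec v + e) n m.
Proof.
move=> M.
have [nu nuP] := choice exists_minimizer.
pose pos (w : 'rV['I_M0]_k) : 'rV[int]_k := \row_i ((w ord0 i : nat) + (reach + N))%N%:Z.
have pos_inj : injective pos.
  move=> w w' ww'; apply/rowP => i; apply/val_inj => /=.
  have := congr1 (fun u : 'rV[int]_k => u ord0 i) ww'; rewrite !mxE => -[/eqP].
  by rewrite eqn_add2r => /eqP.
have [t tq Ht] := @exists_offset q k _
  (fun w i => pos w ord0 i - nu (pos w) ord0 i) (ltnW q1).
pose p w := shrink t (pos w) (nu (pos w)).
have pb w i : N%:Z <= p w ord0 i < (M0 + reach.*2 + N)%N%:Z.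
  have [/(_ i) + _ _] := nuP (pos w).
  have [_] := shr_le q1 tq (pos w ord0 i - nu (pos w) ord0 i).
  have := ltn_ord (w ord0 i); rewrite !mxE.
  exact: shift_in_window.
have /choice[f fP] : forall w, exists v : 'rV['I_M]_k, ivec v = p w.
  by move=> w; apply: exists_ivec => i; have := pb w i; rewrite /M; lia.
pose bad := [pred w : 'rV['I_M0]_k |
  [exists i, (q%:Z %| (pos w ord0 i - nu (pos w) ord0 i + t%:Z)%R)%Z]].
exists (f @: [predC bad])%SET; split.
  rewrite card_in_imset; last first.
    move=> w w'; rewrite !inE => /existsPn gw /existsPn gw' ff.
    have pp : p w = p w' by rewrite -!fP ff.
    apply: pos_inj.
    (* Two sites cannot beat each other at one point, so equal images come from the same tile; there
       injectivity is [shr_inj] in each coordinate. *)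
    have nn : nu (pos w) = nu (pos w').
      apply/eqP; apply: contrapT => /negP nn.
      have e0 : in_box N (0 : 'rV[int]_k) by move=> i; rewrite mxE.
      apply: (@beats_asym (p w + 0) (nu (pos w)) (nu (pos w'))).
        by apply: shrink_deep => //; rewrite eq_sym.
      by rewrite pp; apply: shrink_deep.
    apply/rowP => i.
    have := gw i; have := congr1 (fun u : 'rV[int]_k => u ord0 i) pp.
    rewrite [p w _ _]mxE [p w' _ _]mxE nn => /addrI E gi.
    by have /addIr := shr_inj q1 tq gi (gw' i) E.
  have := cardC bad; have : #|'rV['I_M0]_k| = (M0 ^ k)%N by rewrite card_mx card_ord mul1n.
  move=> -> cE; rewrite card_mx card_ord mul1n in Ht.
  by rewrite -{1}cE mulnDr addnC leq_add2l.
move=> v /imsetP[w _ ->]; split.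
  move=> i; have := congr1 (fun u : 'rV[int]_k => u ord0 i) (fP w).
  by rewrite [LHS]mxE => E; have := pb w i; rewrite -E /M; move: (f w ord0 i : nat) => u; lia.
rewrite fP; exists (nu (pos w)).
  move=> i; rewrite shrink_subE.
  have [/(_ i) + _ _] := nuP (pos w).
  have [+ _] := shr_le q1 tq (pos w ord0 i - nu (pos w) ord0 i).
  by rewrite row_subE; exact: leq_trans.
by move=> e eN m mn; exact: shrink_deep.
Qed.

End Tiling.

(** * Continuous functions on a compact metric space *)

Lemma inf_le_add (R : realType) (Y : Type) (u v : Y -> R) (b c : R) : Y ->
  (forall y, b <= u y) -> (forall y, u y <= v y + c) ->
  inf (range u) <= inf (range v) + c.
Proof.
move=> y0 bu uv; rewrite -lerBlDr; apply: lb_le_inf; first by exists (v y0), y0.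
move=> _ [y _ <-]; rewrite lerBlDr; apply: le_trans (uv y).
by apply: ge_inf; [exists b => _ [z _ <-] | exists y].
Qed.

Section CompactMetric.
Variables (R : realType) (X : topologicalType) (d : X -> X -> R).
Hypotheses (cX : compact [set: X]) (dm : is_metric_for d).

Let d0 : forall x y, 0 <= d x y. Proof. by case: dm. Qed.
Let dxx x : d x x = 0. Proof. by case: dm => _ [/(_ x x)[_ ->]]. Qed.
Let dC : forall x y, d x y = d y x. Proof. by case: dm => _ [_ []]. Qed.
Let dT : forall x y z, d x z <= d x y + d y z. Proof. by case: dm => _ [_ [_ []]]. Qed.

Lemma metric_nbhs x A : nbhs x A <-> exists2 e : R, 0 < e & forall y, d x y < e -> A y.
Proof.
case: dm => _ [_ [_ [_ dO]]]; split.
  rewrite nbhsE => -[B [oB Bx] BA]; have [e e0 eB] := (dO B).1 oB x Bx.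
  by exists e => // y xy; apply/BA/eB.
move=> [e e0 eA]; rewrite nbhsE; exists [set y | d x y < e] => //; split.
  apply/dO => y /= xy; exists (e - d x y); first by rewrite subr_gt0.
  by move=> z /= yz; have := dT x y z; lra.
by rewrite /= dxx.
Qed.

Lemma metric_continuous (f : X -> R) : continuous f <->
  forall x (e : R), 0 < e -> exists2 r : R, 0 < r & forall y, d x y < r -> `|f x - f y| < e.
Proof.
split=> fc x.
  by move=> e e0; apply/metric_nbhs; have /cvgrPdist_lt := fc x; apply.
by apply/cvgrPdist_lt => e e0; apply/metric_nbhs/fc.
Qed.

Lemma lipschitz_continuous (f : X -> R) :
  (forall x y, f x <= f y + d x y) -> continuous f.
Proof.
move=> fl; apply/metric_continuous => x e e0; exists e => // y xy.
rewrite ltr_norml; have := fl x y; have := fl y x; rewrite (dC y x) => *.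
by apply/andP; split; lra.
Qed.

(** Compactness replaces the local radii by one. Using [e] both as radius and as parameter of [P]
    costs nothing since [P] is monotone. *)
Lemma compact_uniform (P : R -> X -> Prop) :
  (forall e e' x, 0 < e' -> e' <= e -> P e x -> P e' x) ->
  (forall x, exists2 e : R, 0 < e & forall y, d x y < e -> P e y) ->
  exists2 e : R, 0 < e & forall x, P e x.
Proof.
move=> Pm Pl; have := (compact_near_coveringP _).1 cX _ (0^'+) P _.
case=> [x _|e0 /= e00 He].
  have [e e0 eP] := Pl x.
  exists ([set y | d x y < e], [set r | 0 < r <= e]) => /=; last first.
    by case=> y r [/= xy /andP[r0 re]]; apply: Pm (eP y xy).
  split; first by apply/metric_nbhs; exists e.
  near=> r; apply/andP; split; near: r; [exact: nbhs_right_gt|exact: nbhs_right_le].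
exists (e0 / 2); first by rewrite divr_gt0.
move=> x; apply: He => //=; last by rewrite divr_gt0.
by rewrite sub0r normrN gtr0_norm ?divr_gt0// ltr_pdivrMr// mulr_natr mulr2n ltrDl.
Unshelve. all: by end_near. Qed.

Lemma uniformly_continuous (f : X -> R) (e : R) : continuous f -> 0 < e ->
  exists2 r : R, 0 < r & forall x y, d x y < r -> `|f x - f y| < e.
Proof.
move=> /metric_continuous fc e0; apply: compact_uniform.
  by move=> r r' x r0 rr H y xy; apply: H; exact: lt_le_trans rr.
move=> x; have [|r r0 H] := fc x (e / 2); first by rewrite divr_gt0.
exists (r / 2); first by rewrite divr_gt0.
move=> y xy z yz; have := H y; have := H z.
have := dT x y z; have := distrC (f x) (f y).
have := ler_distD (f x) (f y) (f z); move=> h1 h2 h3 h4 h5.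
have := h4 ltac:(lra); have := h5 ltac:(lra); rewrite h2 in h1 *; lra.
Qed.

Lemma continuous_bounded (f : X -> R) : continuous f -> exists M : R, forall x, `|f x| <= M.
Proof.
move=> fc.
have [||e e0 He] := @compact_uniform (fun e x => `|f x| <= e^-1).
- by move=> e e' x e0 ee /le_trans; apply; rewrite lef_pV2// posrE// (lt_le_trans e0).
- move=> x; have [r r0 H] := (metric_continuous f).1 fc x 1 ltr01.
  have p1 : 0 < `|f x| + 1 by rewrite ltr_wpDl.
  exists (Num.min r (`|f x| + 1)^-1); first by rewrite lt_min r0 invr_gt0.
  move=> y; rewrite lt_min => /andP[/H xy _].
  rewrite (@le_trans _ _ (`|f x| + 1))//.
    by have := ler_distD 0 (f x) (f y); have := lerB_dist (f y) (f x); rewrite distrC; lra.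
  rewrite -[leLHS]invrK lef_pV2 ?posrE ?lt_min ?r0 ?invr_gt0//.
  by rewrite ge_min lexx orbT.
by exists e^-1.
Qed.

Lemma open_support (U : set X) : open U ->
  exists2 h : X -> R, continuous h & forall x, 0 <= h x /\ (0 < h x <-> U x).
Proof.
(* The infimum of [rho x] is the distance to the complement of [U], truncated at 1; the value 1 on
   [U] covers the case of an empty complement. *)
move=> oU; pose rho x y := if y \in U then 1 else Num.min 1 (d x y).
have rho0 x y : 0 <= rho x y by rewrite /rho; case: ifP => // _; rewrite le_min ler01/=.
exists (fun x => inf (range (rho x))).
  apply: lipschitz_continuous => x y; apply: (@inf_le_add _ _ _ _ 0) => // z.
  rewrite /rho; case: ifP => _; first by rewrite lerDl.
  have := dT x y z; have := d0 x y; rewrite /Num.min.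
  by case: ifPn; case: ifPn; rewrite -?leNgt => *; lra.
move=> x; have h0 : 0 <= inf (range (rho x)).
  by apply: lb_le_inf; [exists (rho x x), x|move=> _ [y _ <-]].
split=> //; split=> [|Ux].
  apply: contraPP => Ux; apply/negP; rewrite -leNgt.
  have -> : 0 = rho x x.
    by rewrite /rho memNset// dxx; apply/esym/min_idPr.
  by apply: ge_inf; [exists 0 => _ [z _ <-]|exists x].
have /metric_nbhs[e e0 eU] : nbhs x U by exact: open_nbhs_nbhs.
apply: (@lt_le_trans _ _ (Num.min 1 e)); first by rewrite lt_min ltr01.
apply: lb_le_inf; first by exists (rho x x), x.
move=> _ [y _ <-]; rewrite /rho; case: ifPn => yU; first by rewrite ge_min lexx.
rewrite le_min ge_min lexx/= ge_min; apply/orP; right.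
rewrite leNgt; apply/negP => /eU Uy; by move: yU; rewrite mem_set.
Qed.

End CompactMetric.

(** * Marker functions *)

Section Marker.
Variables (R : realType) (k : nat) (X : topologicalType) (d : X -> X -> R)
  (T : 'rV[int]_k -> X -> X).
Hypotheses (cX : compact [set: X]) (dm : is_metric_for d) (aT : is_Zk_action T)
  (mT : marker_property T).

(** [phi] is positive only on a marker set for the box of radius [L], which separates its visits. By
    compactness every orbit reaches [h >= e] within a bounded box, so truncating [h / e] at 1
    attains the value 1 with bounded gaps. *)
Lemma marker_function (L : nat) : exists (phi : X -> R) (D : nat),
  [/\ continuous phi, forall x, 0 <= phi x <= 1,
    forall x, exists2 n, in_box D n & phi (T n x) = 1 &
    forall x n, n != 0 -> in_box L n -> 0 < phi x -> phi (T n x) = 0].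
Proof.
have [T0 [TD Tc]] := aT.
have [U [oU [UX Usep]]] := mT [seq bvec v | v : 'rV['I_(L.*2).+1]_k].
have [h hc hP] := open_support dm oU.
have TNK n x : T (- n) (T n x) = x by rewrite -TD addNr T0.
(* One parameter controls both the height reached by [h] and, through its inverse, the size of the
   box searched. *)
have [||e e0 He] := @compact_uniform R X d cX dm
   (fun e x => exists2 n, in_box (Num.truncn e^-1) n & e <= h (T n x)).
- move=> e e' x e0 ee [n nb hn]; exists n; last exact: le_trans hn.
  move=> i; apply: leq_trans (nb i) _; apply: le_truncn.
  by rewrite lef_pV2// posrE// (lt_le_trans e0).
- move=> x; have : [set: X] x by [].
  rewrite -UX => -[n _ [u Uu Tu]].
  have hu : 0 < h u by apply/(hP u).2.
  have Tx : T (- n) x = u by rewrite -Tu TNK.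
  have hTc : continuous (h \o T (- n)) by move=> y; apply: continuous_comp; [exact: Tc|exact: hc].
  have [|r r0 Hr] := (metric_continuous dm (h \o T (- n))).1 hTc x (h u / 2).
    by rewrite divr_gt0.
  pose K := \max_i `|n ord0 i|%N.
  set e := Num.min r (Num.min (h u / 2) K.+1%:R^-1).
  have e0 : 0 < e by rewrite !lt_min r0 divr_gt0//= invr_gt0.
  exists e => // y; rewrite lt_min => /andP[/Hr /= xy _]; exists (- n).
    move=> i; rewrite mxE abszN; apply: (@leq_trans K).
      exact: (leq_bigmax (F := fun i => `|n ord0 i|%N)).
    rewrite truncn_ge_nat ?invr_ge0 ?(ltW e0)//.
    apply: (@le_trans _ _ K.+1%:R); first by rewrite ler_nat.
    by rewrite -[leLHS]invrK lef_pV2 ?posrE ?invr_gt0// !ge_min lexx !orbT.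
  move: xy; rewrite Tx => xy; rewrite ge_min; apply/orP; right.
  rewrite ge_min; apply/orP; left.
  by have := ler_norm (h u - h (T (- n) y)); lra.
exists (fun x => Num.min 1 (h x / e)), (Num.truncn e^-1); split.
- move=> x; apply/cvgrPdist_lt => a a0.
  have := hc x; move/cvgrPdist_lt => /(_ (a * e)) /(_ (mulr_gt0 a0 e0)).
  apply: filterS => y; rewrite -ltr_pdivrMr//; apply: le_lt_trans.
  rewrite -[X in _ <= _ / X](gtr0_norm e0) -normfV -normrM mulrBl.
  rewrite /Num.min; move: (h x / e) (h y / e) => u v.
  have := ler_norm (u - v); have := ler_norm (v - u); rewrite (distrC v u) => *.
  by case: ifPn; case: ifPn; rewrite -?leNgt => *; rewrite ?subrr// ler_norml;
    apply/andP; split; lra.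
- move=> x; rewrite le_min ge_min lexx ler01/= andbT divr_ge0 ?(ltW e0)//.
  by case: (hP x).
- move=> x; have [n nb hn] := He x; exists n => //.
  by apply/min_idPl; rewrite ler_pdivlMr// mul1r.
- move=> x n n0 nb phx.
  have Ux : U x.
    apply/(hP x).2; move: phx; rewrite lt_min => /andP[_].
    by rewrite pmulr_lgt0// invr_gt0.
  have hT : h (T n x) = 0.
    apply/eqP; rewrite eq_le (hP _).1 andbT leNgt; apply/negP => /(hP _).2 UT.
    have [v vE] := in_box_bvec nb.
    have : (U `&` (T n @` U)) (T n x) by split => //; exists x.
    rewrite Usep//; apply/mapP; exists v; rewrite ?mem_enum//.
  by rewrite hT mul0r; apply/min_idPr.
Qed.
End Marker.

(** * Mean dimension zero *)

Lemma row_continuous (X : topologicalType) (Y : topologicalType) n (f : 'I_n -> X -> Y) :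
  (forall i, continuous (f i)) -> continuous (fun x => \row_i f i x).
Proof.
move=> fc x A [P PM PA]; rewrite /nbhs /=.
have : \forall y \near x, forall i, P ord0 i (f i y).
  apply: filter_forall => i; apply: (fc i x).
  by have := PM ord0 i; rewrite mxE.
apply: filterS => y Py; apply: PA => i j; rewrite mxE ord1; exact: Py.
Qed.

Section Widim.
Variables (R : realType) (k : nat) (X : topologicalType) (d : X -> X -> R)
  (T : 'rV[int]_k -> X -> X).
Hypotheses (cX : compact [set: X]) (dm : is_metric_for d) (aT : is_Zk_action T).

Lemma bowen_lt N x y (r : R) : 0 < r ->
  (bowen T d N x y < r) <-> forall v : 'rV['I_N]_k, d (T (ivec v) x) (T (ivec v) y) < r.
Proof.
move=> r0; split=> [/bigmax_ltP[_ +] v|H]; first exact.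
by apply/bigmax_ltP; split => // v _.
Qed.

Lemma bowen_sym N x y : bowen T d N x y = bowen T d N y x.
Proof. by have [_ [_ [dC _]]] := dm; apply: eq_bigr => v _; rewrite dC. Qed.

Lemma bowen_ge0 N x y : 0 <= bowen T d N x y.
Proof. exact: bigmax_ge_id. Qed.

Lemma bowen_triangle N x y z : bowen T d N x z <= bowen T d N x y + bowen T d N y z.
Proof.
have [_ [_ [_ [dT _]]]] := dm.
apply: bigmax_le; first by rewrite addr_ge0 ?bowen_ge0.
move=> v _; apply: le_trans (dT _ (T (ivec v) y) _) _.
by apply: lerD; exact: le_bigmax.
Qed.

Lemma bowen_nbhs N x (r : R) : 0 < r -> nbhs x [set y | bowen T d N x y < r].
Proof.
move=> r0; have [_ [_ Tc]] := aT.
have : \forall y \near x, forall v : 'rV['I_N]_k, d (T (ivec v) x) (T (ivec v) y) < r.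
  apply: filter_forall => v; have := Tc (ivec v) x.
  by move=> /(_ [set y | d (T (ivec v) x) y < r]); apply; apply/(metric_nbhs dm); exists r.
by apply: filterS => y Hy; apply/bowen_lt.
Qed.

Lemma bowen_continuous N x : continuous (bowen T d N x).
Proof.
move=> y; apply/cvgrPdist_lt => e e0.
apply: filterS (bowen_nbhs N y e0) => z yz.
have := bowen_triangle N x y z; have := bowen_triangle N x z y.
rewrite /= in yz; rewrite (bowen_sym N z y) ltr_norml => *; apply/andP; split; lra.
Qed.

Lemma bowen_net N (r : R) : 0 < r ->
  exists s : seq X, forall x, exists2 c, c \in s & bowen T d N c x < r.
Proof.
move=> r0.
(* Finite sequences directed by inclusion serve as parameters, which turns near-covering compactness
   into the extraction of a finite net. *)
pose F := filter_from [set: seq X] (fun s => [set s' : seq X | {subset s <= s'}]).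
have FF : Filter F.
  apply: filter_fromT_filter; first by exists [::].
  move=> s s'; exists (s ++ s') => t st.
  by split=> x xs; apply: st; rewrite mem_cat xs ?orbT.
have [x _|s _ /(_ s) sP] := (compact_near_coveringP _).1 cX _ F
    (fun s x => exists2 c, c \in s & bowen T d N c x < r) FF.
  exists ([set y | bowen T d N x y < r], [set s : seq X | x \in s]).
    split; first exact: bowen_nbhs.
    by exists [:: x] => // s; apply; rewrite mem_head.
  by case=> y s [/= xy xs]; exists x.
by exists s => x; apply: sP.
Qed.

(** This keeps the set in [widim] nonempty, so that its infimum is meaningful. A partition of unity
    subordinate to the [e/3]-balls of a finite net maps into the full simplex; points with the same
    image share a net point within [e/3]. *)
Lemma exists_eps_embeds N (e : R) : 0 < e -> exists m, eps_embeds (bowen T d N) e m.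
Proof.
move=> e0; have r0 : 0 < e / 3 by rewrite divr_gt0.
have [s sP] := bowen_net N r0.
pose c (i : 'I_(size s)) := tnth (in_tuple s) i.
pose w i x := Num.max 0 (e / 3 - bowen T d N (c i) x).
have w0 i x : 0 <= w i x by rewrite le_max lexx.
have wc i : continuous (w i).
  move=> x; apply: (@continuous_max R X (cst 0) (fun x => e / 3 - bowen T d N (c i) x)).
    exact: cst_continuous.
  by apply: cvgB; [exact: cvg_cst|exact: bowen_continuous].
pose W x := \sum_i w i x.
have W0 x : 0 < W x.
  have [a as_ ax] := sP x; have [i ai] := seq_tnthP as_.
  rewrite /W (bigD1 i)//= ltr_pwDl ?sumr_ge0// lt_max; apply/orP; right.
  by rewrite subr_gt0 /c -ai.
have Wc : continuous W.
  by apply: continuous_big; [exact: add_continuous | move=> i _; exact: wc].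
exists (sc_dim [set t : {set 'I_(size s)} | t != finset.set0]%SET).
exists (size s), [set t | t != finset.set0]%SET, (fun x => \row_i (w i x / W x)); split=> //.
- split; first by rewrite !inE eqxx.
  by move=> a b _ b0 _; rewrite inE.
- apply: (@row_continuous _ _ _ (fun i x => w i x / W x)) => i x.
  by apply: cvgM; [exact: wc|apply: cvgV; [rewrite gt_eqF|exact: Wc]].
- move=> x; split; first by move=> i; rewrite mxE divr_ge0// ltW.
  have sum1 : \sum_i w i x / W x = 1 by rewrite -mulr_suml -/(W x) divff// gt_eqF// W0.
  split; first by rewrite -[RHS]sum1; apply: eq_bigr => i _; rewrite mxE.
  rewrite inE; apply/eqP => /setP st; move: sum1; rewrite big1 => [/eqP|i _].
    by rewrite eq_sym oner_eq0.
  by have := st i; rewrite !inE mxE => /negbFE/eqP.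
- move=> t; exists (2 * (e / 3)); first by lra.
  move=> x y Fx Fy; have [a as_ ax] := sP x; have [i ai] := seq_tnthP as_.
  have wx : 0 < w i x by rewrite lt_max subr_gt0 /c -ai ax orbT.
  have : w i y / W y = w i x / W x.
    have := congr1 (fun u : 'rV[R]_(size s) => u ord0 i) (etrans Fy (esym Fx)).
    by rewrite !mxE.
  move=> E; have : 0 < w i y.
    by have := divr_gt0 wx (W0 x); rewrite -E pmulr_lgt0// invr_gt0.
  rewrite lt_max ltxx/= subr_gt0 /c -ai => ay.
  have := bowen_triangle N x a y; rewrite (bowen_sym N x a); lra.
Qed.

Lemma mdim0_eps_embeds (e0 eta : R) : mdim_is T d 0 -> 0 < e0 -> 0 < eta ->
  exists (e : R) N m, [/\ 0 < e <= e0, (0 < N)%N, eps_embeds (bowen T d N) e m &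
    m%:R <= eta * N%:R ^+ k].
Proof.
move=> [g [gN g0]] e00 eta0.
have : \forall e \near (0 : R)^'+, [/\ 0 < e, e <= e0 & `|0 - g e| < eta].
  near=> e; split; near: e; [exact: nbhs_right_gt|exact: nbhs_right_le|].
  by move/cvgrPdist_lt: g0; apply.
case/filter_ex => e [ep ee0]; rewrite sub0r normrN => ge.
have : \forall N \near \oo, (0 < N)%N /\ (N%:R ^+ k)^-1 * widim (bowen T d N) e < eta.
  near=> N; split; near: N; first exact: nbhs_infty_gt.
  have : g e < eta by apply: le_lt_trans ge; exact: ler_norm.
  have /cvgr_lt := gN e ep; apply.
case/filter_ex => N [N0 Hw].
have NR : 0 < N%:R ^+ k :> R by rewrite exprn_gt0// ltr0n.
have {}Hw : widim (bowen T d N) e < eta * N%:R ^+ k.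
  by move: Hw; rewrite mulrC ltr_pdivrMr.
have [m0 m0P] := exists_eps_embeds N ep.
have [|_ [m mP <-] /ltW Hm] := inf_lt _ Hw; first by exists m0%:R, m0.
by exists e, N, m; split=> //; rewrite ep.
Unshelve. all: by end_near. Qed.

End Widim.

(** * Generic constants avoiding many common zeros *)

Section GenericShift.
Variables (R : realType) (X : Type) (J : finType) (n m : nat).
Variables (S : {set {set 'I_n}}) (F : X -> 'rV[R]_n) (psi : J -> X -> R) (C eps : R).
Hypotheses (Sm : (sc_dim S <= m)%N)
  (FS : forall x, realization S (F x)) (C0 : 0 <= C) (eps0 : 0 < eps)
  (psiC : forall j x y (delta : R), 0 <= delta -> (forall i, `|F x ord0 i - F y ord0 i| <= delta) ->
    `|psi j x - psi j y| <= C * delta).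

Definition face (x : X) : {set 'I_n} := finset (fun i => F x ord0 i != 0).

Lemma face_size x : (size (enum (face x)) <= m.+1)%N.
Proof.
have [_ [_ sS]] := FS x; rewrite -cardE.
have : (#|face x|.-1 <= sc_dim S)%N.
  by apply: (leq_bigmax_cond (F := fun s : {set 'I_n} => #|s|.-1)).
by move=> /leq_trans /(_ Sm); case: #|_|.
Qed.

(** The index [l.+1] skips the first vertex of the face, whose coordinate is determined because the
    sum is 1; indices past the end read the default 0. Recording [m] coordinates instead of [m + 1]
    makes the number of cells grow like [Q^m], one power below the number of constraints in
    [generic_shift]. *)
Definition cell (Q : nat) (x : X) : {set 'I_n} * {ffun 'I_m -> 'I_Q.+1} :=
  (face x, [ffun l : 'I_m =>
     inord (Num.truncn (Q%:R * [seq F x ord0 i | i <- enum (face x)]`_l.+1))]).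

Lemma coord_in01 x i : 0 <= F x ord0 i <= 1.
Proof.
have [F0 [F1 _]] := FS x; rewrite F0/= -F1 (bigD1 i)//= lerDl.
by apply: sumr_ge0.
Qed.

Lemma truncn_near (a b : R) : 0 <= a -> 0 <= b -> Num.truncn a = Num.truncn b ->
  `|a - b| <= 1.
Proof.
move=> a0 b0; have := truncn_itv a0; have := truncn_itv b0.
move=> /andP[+ +] /andP[+ +] ab; rewrite ab -natr1 => *.
by rewrite ler_norml; apply/andP; split; lra.
Qed.

(** Recorded coordinates differ by at most [1/Q]; the omitted one is 1 minus a sum of at most [m] of
    them. *)
Lemma cell_near Q x y : (0 < Q)%N -> cell Q x = cell Q y ->
  forall i, `|F x ord0 i - F y ord0 i| <= m.+1%:R / Q%:R.
Proof.
move=> Q0 [fxy /ffunP vxy].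
have Q0R : 0 < Q%:R :> R by rewrite ltr0n.
have bound0 : 0 <= m.+1%:R / Q%:R :> R by rewrite divr_ge0.
have tail i : i \in face x -> (0 < index i (enum (face x)))%N ->
    `|F x ord0 i - F y ord0 i| <= Q%:R^-1.
  move=> ix ipos.
  have ixe : i \in enum (face x) by rewrite mem_enum.
  have lm : ((index i (enum (face x))).-1 < m)%N.
    by move: ixe; rewrite -index_mem => /leq_trans/(_ (face_size x)); lia.
  have := vxy (Ordinal lm); rewrite !ffunE -fxy /= prednK//.
  rewrite !(nth_map i) ?index_mem// nth_index// => /(congr1 val)/=.
  have bnd z : (Num.truncn (Q%:R * F z ord0 i) < Q.+1)%N.
    have [z0 z1] := andP (coord_in01 z i).
    rewrite truncn_lt_nat ?mulr_ge0//.
    by rewrite (@le_lt_trans _ _ Q%:R) ?ltr_nat// ler_piMr.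
  rewrite !inordK// => /truncn_near; rewrite -mulrBr normrM (gtr0_norm Q0R).
  rewrite -ler_pdivlMl// mulr1; apply; rewrite mulr_ge0//.
    by have /andP[] := coord_in01 x i.
  by have /andP[] := coord_in01 y i.
move=> i.
have [ix|/negP ix] := boolP (i \in face x); last first.
  have xi : F x ord0 i = 0 by apply/eqP; apply: contrapT => /negP h; apply: ix; rewrite inE.
  have yi : F y ord0 i = 0 by apply/eqP; apply: contrapT => /negP h; apply: ix; rewrite fxy inE.
  by rewrite xi yi subrr normr0.
have [i1|] := posnP (index i (enum (face x))); last first.
  move=> /(tail _ ix)/le_trans; apply.
  by rewrite -[leLHS]mul1r ler_wpM2r ?invr_ge0 ?ler1n// ltW.
have sumF z : face z = face x -> F z ord0 i = 1 - \sum_(l in face x :\ i) F z ord0 l.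
  move=> zx; have [_ [F1 _]] := FS z.
  have {}F1 : 1 = F z ord0 i + \sum_(l in face x :\ i) F z ord0 l.
    rewrite -F1 (bigID (mem (face x)))/= [X in _ + X]big1 ?addr0.
      by rewrite (big_setD1 i).
    by move=> l; rewrite -zx inE negbK => /eqP.
  by rewrite F1 addrK.
rewrite (sumF x)// (sumF y)//.
have -> (a b : R) : 1 - a - (1 - b) = b - a by ring.
rewrite -sumrB.
apply: (le_trans (ler_norm_sum _ _ _)).
apply: (@le_trans _ _ (\sum_(l in face x :\ i) Q%:R^-1)).
  apply: ler_sum => l; rewrite in_setD1 => /andP[li lx].
  rewrite distrC; apply: tail => //; rewrite lt0n; apply: contra_neq li => l0.
  by rewrite -[l](@nth_index _ i _ (enum (face x))) ?mem_enum// l0 -i1 nth_index// mem_enum.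
rewrite sumr_const -[leLHS]mulr_natl ler_wpM2r ?invr_ge0 ?(ltW Q0R)// ler_nat.
have := cardsD1 i (face x); rewrite ix => h.
have := face_size x; rewrite -cardE h add1n ltnS => hm.
exact: (leq_trans hm (leqnSn m)).
Qed.

(** Count shifts on the grid [eps b / B], [b < B]. If a shift has more than [m] zeros at some point,
    the cell of the point and the zero set [Z] pin down its grid values on [Z], which leaves a
    proportion at most [B^-(m+1)] of all shifts. Such labels number only a constant times [B^m], so
    for large [B] some shift escapes. *)
Lemma generic_shift : exists c : J -> R, (forall j, 0 <= c j <= eps) /\
  forall x, (#|[pred j | (psi j x + c j)%R == 0%R]| <= m)%N.
Proof.
(* With [Q = K B], the variation [C * delta] over a cell stays below half the grid step [eps / B],
   so at most one grid value cancels [psi j] up to that error. *)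
pose K := (Num.truncn (2 * C * m.+1%:R / eps)).+1.
have K0 : (0 < K)%N by [].
have KC : 2 * C * m.+1%:R < eps * K%:R.
  by rewrite -ltr_pdivrMl// mulrC truncnS_gt.
(* [K] is fixed before [B], so [B] may exceed the constant in front of [B^m] in [cardW]. *)
pose B := (K.+1 ^ m * 2 ^ (n + #|J|)).+1.
have B0 : 0 < B%:R :> R by rewrite ltr0n.
pose Q := (K * B)%N.
have Q0 : (0 < Q)%N by rewrite muln_gt0.
pose c (a : {ffun J -> 'I_B}) j : R := eps * (a j : nat)%:R / B%:R.
have c01 a j : 0 <= c a j <= eps.
  rewrite /c divr_ge0 ?mulr_ge0 ?(ltW eps0)//=.
  by rewrite ler_pdivrMr// ler_pM2l// ler_nat ltnW.
apply: contrapT => /forallNP Hno.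
have {}Hno a : exists x, (m < #|finset (fun j => (psi j x + c a j)%R == 0%R)|)%N.
  apply: contrapT => /forallNP Ha; apply: (Hno (c a)); split=> // x.
  by rewrite leqNgt; apply/negP => h; apply: (Ha x); rewrite cardsE.
have [xa xaP] := choice Hno.
pose a0 : {ffun J -> 'I_B} := [ffun=> ord0].
(* The representative of a cell does not depend on the shift, so a label alone determines the
   constraint. *)
have /choice[r rP] : forall l, exists x, (exists y, cell Q y = l) -> cell Q x = l.
  by move=> l; have [[y yl]|] := pselect (exists y, cell Q y = l); [exists y|exists (xa a0)].
pose delta : R := m.+1%:R / Q%:R.
pose near1 (l : {set 'I_n} * {ffun 'I_m -> 'I_Q.+1}) j : pred 'I_B :=
  fun b => `|psi j (r l) + eps * (b : nat)%:R / B%:R| <= C * delta.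
pose fam (p : ({set 'I_n} * {ffun 'I_m -> 'I_Q.+1}) * {set J}) : J -> pred 'I_B :=
  fun j => if j \in p.2 then near1 p.1 j else predT.
have near1_card l j : (#|near1 l j| <= 1)%N.
  apply/card_le1_eqP => b b' hb hb'.
  have {}hb : near1 l j b := hb.
  have {}hb' : near1 l j b' := hb'.
  rewrite /near1 in hb hb'.
  apply/val_inj => /=.
  have : `|eps * (b : nat)%:R / B%:R - eps * (b' : nat)%:R / B%:R| <= 2 * (C * delta).
    move: hb hb'; rewrite !ler_norml => /andP[? ?] /andP[? ?].
    by apply/andP; split; lra.
  have -> : eps * (b : nat)%:R / B%:R - eps * (b' : nat)%:R / B%:R =
      ((b : nat)%:Z - (b' : nat)%:Z)%:~R * (eps / B%:R).
    by rewrite intrB /= -!pmulrn; ring.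
  rewrite normrM normr_int_nat [`|eps / _|]gtr0_norm ?divr_gt0// => h.
  have KR : 0 < K%:R :> R by rewrite ltr0n.
  have : `|((b : nat)%:Z - (b' : nat)%:Z)%R|%N%:R < 1%:R :> R.
    rewrite -(ltr_pM2r (divr_gt0 eps0 B0)); apply: (le_lt_trans h).
    rewrite mul1r ltr_pdivlMr// /delta /Q natrM.
    have -> : 2 * (C * (m.+1%:R / (K%:R * B%:R))) * B%:R = 2 * C * m.+1%:R / K%:R.
      by field; rewrite !gt_eqF.
    by rewrite ltr_pdivrMr.
  rewrite ltr_nat; lia.
pose big (Z : {set J}) := (m < #|Z|)%N.
have fam_card p : big p.2 -> (#|family (fam p)| * B ^ m.+1 <= B ^ #|J|)%N.
  move=> Zm; rewrite card_family.
  have -> : foldr muln 1%N [seq #|fam p j| | j : J] = (\prod_(j : J) #|fam p j|)%N.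
    by rewrite foldrE big_map big_enum.
  rewrite (bigID (mem p.2))/=.
  apply: (@leq_trans (1 * B ^ #|[predC p.2]| * B ^ #|p.2|))%N.
    apply: leq_mul; last exact: leq_pexp2l.
    apply: leq_mul.
      apply: (@leq_trans (\prod_(j in p.2) 1)%N); last by rewrite big1_eq.
      by apply: leq_prod => j jp; rewrite /fam jp; exact: near1_card.
    rewrite -prod_nat_const; apply: leq_prod => j /negbTE jp.
    by rewrite /fam jp -[leqRHS]card_ord; exact: max_card.
  by rewrite mul1n -expnD addnC cardC.
pose W : finType := (({set 'I_n} * {ffun 'I_m -> 'I_Q.+1}) * {set J})%type.
pose lab (a : {ffun J -> 'I_B}) : W :=
  (cell Q (xa a), finset (fun j => (psi j (xa a) + c a j)%R == 0%R)).
have labP a : big (lab a).2 && (a \in family (fam (lab a))).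
  apply/andP; split; first exact: xaP.
  apply/familyP => j; rewrite /fam /=; case: ifPn => // jZ.
  have {}jZ : psi j (xa a) + c a j = 0 by move: jZ; rewrite /lab /= finset.in_set => /eqP.
  have rl : cell Q (r (cell Q (xa a))) = cell Q (xa a).
    by apply: rP; exists (xa a).
  have ca : c a j = - psi j (xa a).
    by apply/eqP; rewrite -addr_eq0 addrC jZ.
  by rewrite unfold_in /near1 /= -/(c a j) ca;
    apply: psiC; [exact: divr_ge0|exact: (cell_near Q0 rl)].
have cardW : (#|W| <= 2 ^ (n + #|J|) * (K.+1 * B) ^ m)%N.
  rewrite !card_prod card_ffun !card_ord -!cardsT -!powersetT !card_powerset !cardsT card_ord.
  rewrite mulnAC -expnD leq_mul2l; apply/orP; right.
  have [->|m0] := posnP m; first by rewrite !expn0.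
  by rewrite leq_exp2r// /Q mulSn; lia.
(* Every shift belongs to the family of its own label. The factor [B ^ m.+1] stays on the left to
   avoid truncated subtraction in the exponent. *)
have : (B ^ #|J| * B ^ m.+1 <= #|W| * B ^ #|J|)%N.
  apply: (@leq_trans ((\sum_(p : W | big p.2) #|family (fam p)|) * B ^ m.+1)%N).
    rewrite leq_mul2r; apply/orP; right.
    rewrite -[X in (X ^ _)%N](card_ord B) -card_ffun -sum1_card.
    apply: (@leq_trans (\sum_(a : {ffun J -> 'I_B}) \sum_(p : W | big p.2)
        (a \in family (fam p)))%N).
      apply: leq_sum => a _; have /andP[l1 l2] := labP a.
      by rewrite (bigD1 (lab a))//= l2.
    rewrite exchange_big /=; apply: leq_sum => p _.
    by rewrite -sum1_card [leqRHS]big_mkcond; apply: leq_sum => a _; case: ifP.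
  rewrite big_distrl/=; apply: (@leq_trans (\sum_(p : W | big p.2) B ^ #|J|)%N).
    by apply: leq_sum => p; exact: fam_card.
  by rewrite sum_nat_const leq_mul2r max_card orbT.
rewrite mulnC leq_pmul2r ?expn_gt0// => h; have {h} := leq_trans h cardW.
rewrite expnS expnMn mulnA leq_pmul2r ?expn_gt0// mulnC /B ltnn.
by [].
Qed.
End GenericShift.

(** * Block functions with few zeros *)

Section Blocks.
Variables (R : realType) (k : nat) (X : topologicalType) (d : X -> X -> R)
  (T : 'rV[int]_k -> X -> X).
Hypotheses (cX : compact [set: X]) (dm : is_metric_for d) (aT : is_Zk_action T).

Let fiber_gap n (F : X -> 'rV[R]_n) x y : R := \big[Num.max/0]_i `|F x ord0 i - F y ord0 i|.

(** Compactness in both points passes from exact to approximate fibers. Near a pair on one fiber the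
    bound comes from the fiber diameter and continuity; near a pair on different fibers some
    coordinate gap persists, so a small gap is impossible. *)
Lemma fibers_uniform n (F : X -> 'rV[R]_n) N (f : X -> R) (e eps : R) :
  continuous F -> continuous f -> 0 < eps ->
  (forall x y, d x y < e -> `|f x - f y| < eps) ->
  (forall x y, F x = F y -> bowen T d N x y < e) ->
  exists2 r : R, 0 < r & forall x y, fiber_gap F x y <= r ->
    forall v : 'rV['I_N]_k, `|f (T (ivec v) x) - f (T (ivec v) y)| < 2 * eps.
Proof.
move=> Fc fc eps0 fe Fe; have [_ [_ Tc]] := aT.
have gap_sup x y i : `|F x ord0 i - F y ord0 i| <= fiber_gap F x y.
  exact: le_bigmax.
have fT x (a : R) : 0 < a -> exists2 r : R, 0 < r & forall x', d x x' < r ->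
    forall v : 'rV['I_N]_k, `|f (T (ivec v) x) - f (T (ivec v) x')| < a.
  move=> a0; apply/(metric_nbhs dm); apply: filter_forall => v.
  have : continuous (f \o T (ivec v)) by move=> z; apply: continuous_comp; [exact: Tc|exact: fc].
  by move=> /(_ x)/cvgrPdist_lt; apply.
have local x y : exists2 r : R, 0 < r & forall x' y', d x x' < r -> d y y' < r ->
    fiber_gap F x' y' <= r ->
    forall v : 'rV['I_N]_k, `|f (T (ivec v) x') - f (T (ivec v) y')| < 2 * eps.
  have [Fxy|Fxy] := pselect (F x = F y).
    have [r1 r10 H1] := fT x (eps / 2) ltac:(by rewrite divr_gt0).
    have [r2 r20 H2] := fT y (eps / 2) ltac:(by rewrite divr_gt0).
    exists (Num.min r1 r2); first by rewrite lt_min r10.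
    move=> x' y'; rewrite !lt_min => /andP[xx _] /andP[_ yy] _ v.
    have e0 : 0 < e by apply: le_lt_trans (Fe x y Fxy); exact: bowen_ge0.
    have := fe _ _ ((@bowen_lt R k X d T N x y e e0).1 (Fe _ _ Fxy) v).
    move: (H1 _ xx v) (H2 _ yy v).
    by rewrite !ltr_norml => /andP[? ?] /andP[? ?] /andP[? ?]; apply/andP; split; lra.
  have [i Fi] : exists i, F x ord0 i != F y ord0 i.
    apply: contrapT => /forallNP H; apply: Fxy; apply/rowP => i.
    by apply/eqP; apply: contrapT => /negP /(H i).
  pose a := `|F x ord0 i - F y ord0 i| / 3.
  have a0 : 0 < a by rewrite divr_gt0// normr_gt0 subr_eq0.
  have Fic : continuous (fun z => F z ord0 i).
    move=> z; apply: (@continuous_comp _ _ _ F (fun M => M ord0 i)); first exact: Fc.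
    exact: coord_continuous.
  have [r1 r10 H1] := (metric_continuous dm _).1 Fic x a a0.
  have [r2 r20 H2] := (metric_continuous dm _).1 Fic y a a0.
  exists (Num.min (Num.min r1 r2) (a / 2)); first by rewrite !lt_min r10 r20 divr_gt0.
  move=> x' y'; rewrite !lt_min !le_min => /andP[/andP[/H1 xx _] _] /andP[/andP[_ /H2 yy] _].
  move=> /andP[_ ga] v; exfalso.
  have := gap_sup x' y' i.
  have : `|F x ord0 i - F y ord0 i| = 3 * a by rewrite /a; field.
  have := ler_normD (F x ord0 i - F x' ord0 i) (F x' ord0 i - F y ord0 i).
  have := ler_normD (F x' ord0 i - F y' ord0 i) (F y' ord0 i - F y ord0 i).
  rewrite !addrA !subrK (distrC (F y' _ _)); lra.
have [||r r0 H] := @compact_uniform R X d cX dm (fun r x => forall y, fiber_gap F x y <= r ->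
    forall v : 'rV['I_N]_k, `|f (T (ivec v) x) - f (T (ivec v) y)| < 2 * eps).
- by move=> r r' x r0 rr H y xy; apply: H; exact: le_trans rr.
- move=> x.
  have [||r r0 H] := @compact_uniform R X d cX dm (fun r y => forall x', d x x' < r ->
      fiber_gap F x' y <= r ->
      forall v : 'rV['I_N]_k, `|f (T (ivec v) x') - f (T (ivec v) y)| < 2 * eps).
  + move=> r r' y r0 rr H x' xx g; apply: H; [exact: lt_le_trans rr|exact: le_trans rr].
  + by move=> y; have [r r0 H] := local x y; exists r => // y' yy x' xx g; exact: H.
  + by exists r => // x' xx y g; exact: H.
- by exists r => // x y; exact: H.
Qed.

Lemma block_functions (f : X -> R) (eps eta : R) : mdim_is T d 0 -> continuous f ->
  0 < eps -> 0 < eta -> exists N (psi : 'rV['I_N]_k -> X -> R),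
  [/\ (0 < N)%N, forall v, continuous (psi v),
    forall v x, `|psi v x - f (T (ivec v) x)| <= eps &
    forall x, #|[pred v | psi v x == 0%R]|%:R <= eta * N%:R ^+ k].
Proof.
move=> md fc eps0 eta0.
have [x0|X0] := pselect (inhabited X); last first.
  exists 1, (fun _ _ => 0); split=> // [v|v x|x]; first exact: cst_continuous.
    by exfalso; apply: X0.
  by exfalso; apply: X0.
have {}x0 : X by case: (cid (let: inhabits x := x0 in ex_intro (fun=> True) x I)).
have eps4 : 0 < eps / 4 by rewrite divr_gt0.
have [e0 e00 fe0] := uniformly_continuous cX dm fc eps4.
have [e [N [m [/andP[ep ee0] N0 [n [S [F [SC Sm Fc FS Fe]]]] mN]]]] :=
  mdim0_eps_embeds cX dm aT md e00 eta0.
have [r r0 Hr] : exists2 r : R, 0 < r & forall x y, fiber_gap F x y <= r ->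
    forall v : 'rV['I_N]_k, `|f (T (ivec v) x) - f (T (ivec v) y)| < 2 * (eps / 4).
  apply: (@fibers_uniform _ _ _ _ e) => // x y.
    by move=> xy; apply: fe0; exact: lt_le_trans ee0.
  by move=> Fxy; have [a ae Ha] := Fe (F y); exact: le_lt_trans (Ha _ _ Fxy erefl) ae.
have [M fM] := continuous_bounded cX dm fc.
have M0 : 0 <= M by exact: le_trans (normr_ge0 _) (fM x0).
(* Across a gap above [r] the penalty [C * fiber_gap] exceeds the oscillation of [f], and across a
   smaller gap [f] changes by less than [eps / 2]. Hence the McShane infimum [phi] lies at most
   [eps / 2] below [f]. *)
pose C := (2 * M + 1) / r.
have C0 : 0 <= C by rewrite divr_ge0 ?(ltW r0)// addr_ge0// mulr_ge0.
have gap_triangle x y z : fiber_gap F x z <= fiber_gap F y z + fiber_gap F x y.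
  apply: bigmax_le => [|i _]; first by rewrite addr_ge0// bigmax_ge_id.
  rewrite [leRHS]addrC; apply: le_trans (ler_distD (F y ord0 i) _ _) _.
  by apply: lerD; exact: le_bigmax.
have gap0 x : fiber_gap F x x = 0.
  apply/eqP; rewrite eq_le bigmax_ge_id andbT.
  by apply: bigmax_le => // i _; rewrite subrr normr0.
pose phi (v : 'rV['I_N]_k) x := inf (range (fun y => f (T (ivec v) y) + C * fiber_gap F x y)).
have lower v x y : - M <= f (T (ivec v) y) + C * fiber_gap F x y.
  have := fM (T (ivec v) y); rewrite ler_norml => /andP[h _].
  by rewrite -[leLHS]addr0 lerD// mulr_ge0// bigmax_ge_id.
have phi_lip v x y : phi v x <= phi v y + C * fiber_gap F x y.
  apply: (@inf_le_add _ _ _ _ (- M)) => // z.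
  by rewrite -addrA lerD2l -mulrDr ler_wpM2l.
have gapC x y : fiber_gap F x y = fiber_gap F y x.
  by apply: eq_bigr => i _; rewrite distrC.
have phi_near v x : f (T (ivec v) x) - eps / 2 <= phi v x <= f (T (ivec v) x).
  apply/andP; split.
    apply: lb_le_inf; first by exists (f (T (ivec v) x0) + C * fiber_gap F x x0), x0.
    move=> _ [y _ <-]; have [g|g] := lerP (fiber_gap F x y) r.
      have := Hr x y g v; rewrite ltr_norml => /andP[_ h].
      have : 0 <= C * fiber_gap F x y by rewrite mulr_ge0// bigmax_ge_id.
      lra.
    have : 2 * M + 1 <= C * fiber_gap F x y.
      by rewrite /C mulrAC ler_pdivlMr// ler_wpM2l ?ltW// ltr_wpDl// mulr_ge0.
    have := fM (T (ivec v) x); have := fM (T (ivec v) y).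
    rewrite !ler_norml => /andP[? ?] /andP[? ?] ?; lra.
  apply: ge_inf; first by exists (- M) => _ [y _ <-].
  by exists x => //; rewrite gap0 mulr0 addr0.
have phi_cont v : continuous (phi v).
  move=> x; apply/cvgrPdist_lt => a a0.
  have a1 : 0 < a / (C + 1) by rewrite divr_gt0// ltr_wpDl.
  have : \forall y \near x, forall i, `|F x ord0 i - F y ord0 i| < a / (C + 1).
    apply: filter_forall => i.
    have : {for x, continuous (fun z => F z ord0 i)}.
      by apply: (@continuous_comp _ _ _ F (fun M => M ord0 i)); [exact: Fc|exact: coord_continuous].
    by move/cvgrPdist_lt; apply.
  apply: filterS => y Hy.
  have g : fiber_gap F x y <= a / (C + 1).
    by apply: bigmax_le => [|i _]; rewrite ltW.
  have : C * fiber_gap F x y < a.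
    apply: (@le_lt_trans _ _ (C * (a / (C + 1)))); first by rewrite ler_wpM2l.
    rewrite mulrCA gtr_pMr// ltr_pdivrMr ?ltr_wpDl// mul1r ltrDl//.
  have := phi_lip v x y; have := phi_lip v y x; rewrite (gapC y x) => *.
  by rewrite ltr_norml; apply/andP; split; lra.
have eps2 : 0 < eps / 2 by rewrite divr_gt0.
have Sm' : (sc_dim S <= m)%N by rewrite Sm.
have [|c [c01 cP]] := @generic_shift R X _ n m S F phi C (eps / 2) Sm' FS C0 eps2.
  move=> v x y a a0 Ha.
  have g : fiber_gap F x y <= a by apply: bigmax_le.
  have : C * fiber_gap F x y <= C * a by rewrite ler_wpM2l.
  have := phi_lip v x y; have := phi_lip v y x; rewrite (gapC y x) => *.
  by rewrite ler_norml; apply/andP; split; lra.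
exists N, (fun v x => phi v x + c v); split=> //.
- by move=> v x; apply: cvgD; [exact: phi_cont|exact: cvg_cst].
- move=> v x; have /andP[? ?] := phi_near v x; have /andP[? ?] := c01 v.
  by rewrite ler_norml; apply/andP; split; lra.
- by move=> x; apply: le_trans mN; rewrite ler_nat.
Qed.
End Blocks.

(** * Counting zeros along an orbit *)

(** Blocks are the cells of the grid of mesh [N] anchored at the site [n], so a block is recovered
    from [n] and any of its points [v]. *)
Lemma block_base (N : nat) (a n v j : int) : 0 <= j < N%:Z ->
  v = a - ((a - n) %% N%:Z)%Z + j ->
  a - ((a - n) %% N%:Z)%Z = n + ((v - n) %/ N%:Z)%Z * N%:Z.
Proof.
move=> /andP[j0 jN] ->.
have N0 : N%:Z != 0 by lia.
have -> : a - ((a - n) %% N%:Z)%Z + j - n = ((a - n) %/ N%:Z)%Z * N%:Z + j.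
  by rewrite -{1}[a](subrK n) {1}(divz_eq (a - n) N%:Z); ring.
have small : (j %/ N%:Z)%Z = 0 by apply: divz_small; rewrite j0.
rewrite divzMDl// small addr0.
by rewrite -{1}[a](subrK n) {1}(divz_eq (a - n) N%:Z); ring.
Qed.

Section Count.
Variables (R : realType) (k : nat) (H : 'rV[int]_k -> R) (q N D : nat) (eta : R).
Variables (jn : 'rV[int]_k -> 'rV['I_N]_k) (G : 'rV[int]_k -> R)
  (Psi : 'rV['I_N]_k -> 'rV[int]_k -> R) (M M0 reach : nat).
Variable Z : {set 'rV['I_M]_k}.
Hypotheses (N0 : (0 < N)%N)
  (jnP : forall n i, ivec (jn n) ord0 i = ((- n ord0 i) %% N%:Z)%Z)
  (Gdeep : forall p n, in_box (reach + N) (n - p) ->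
     (forall m, m != n -> beats H p n m) ->
     G p = Psi (jn (n - p)) (p - ivec (jn (n - p))))
  (Psi0 : forall b, #|[pred j | Psi j b == 0%R]|%:R <= eta * N%:R ^+ k)
  (ZP : forall v, v \in Z ->
      (forall i, (N <= v ord0 i)%N && (v ord0 i + N < M)%N) /\
      exists2 n, in_box reach (ivec v - n) &
        forall e, in_box N e -> forall m, m != n -> beats H (ivec v + e) n m).

(** Double counting of pairs of a deep zero [p] and a point [v] of its block. Each [p] has [N^k]
    such [v], all in the window thanks to the margin [N]. Conversely [v] determines the site, hence
    the base of the block, and the deep zeros there correspond to indices [j] with [Psi j] zero at
    that base. *)
Lemma deep_zeros : #|[pred v in Z | G (ivec v) == 0%R]|%:R <= eta * M%:R ^+ k.
Proof.
have NR : 0 < N%:R ^+ k :> R by rewrite exprn_gt0// ltr0n.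
have /choice[nu nuP] : forall v, exists n, v \in Z -> in_box reach (ivec v - n) /\
    forall e, in_box N e -> forall m, m != n -> beats H (ivec v + e) n m.
  move=> v; have [vZ|_] := boolP (v \in Z); last by exists 0.
  by have [_ [n n1 n2]] := ZP vZ; exists n.
pose off p := jn (nu p - ivec p).
pose base p := ivec p - ivec (off p).
have offE p i : ivec (off p) ord0 i = ((ivec p ord0 i - nu p ord0 i) %% N%:Z)%Z.
  by rewrite jnP !mxE opprD opprK addrC.
have baseDE p j i : (base p + ivec j) ord0 i =
    ivec p ord0 i - ivec (off p) ord0 i + ivec j ord0 i by rewrite /base !mxE.
have ivec_bound K (j : 'rV['I_K]_k) i : 0 <= ivec j ord0 i < K%:Z.
  by rewrite mxE ltz_nat ltn_ord.
pose blk p (v : 'rV['I_M]_k) := [exists j : 'rV['I_N]_k, ivec v == base p + ivec j].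
pose bad := [pred v in Z | G (ivec v) == 0%R].
have blk_size p : p \in bad -> (N ^ k <= #|[pred v | blk p v]|)%N.
  move=> /andP[pZ _]; have [pM _] := ZP pZ.
  have /choice[f fP] : forall j : 'rV['I_N]_k, exists v : 'rV['I_M]_k, ivec v = base p + ivec j.
    move=> j; apply: exists_ivec => i.
    have pE : ivec p ord0 i = (p ord0 i : nat)%:Z by rewrite mxE.
    rewrite baseDE pE.
    have := ivec_bound _ j i; have := ivec_bound _ (off p) i; have := pM i.
    by move: (ivec (off p) _ _) (ivec j _ _) (nat_of_ord (p _ _)) => a b c; lia.
  have <- : #|'rV['I_N]_k| = (N ^ k)%N by rewrite card_mx card_ord mul1n.
  rewrite -(@card_imset _ _ f); last first.
    move=> j j' ff; apply: ivec_inj; apply: (@addrI _ (base p)).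
    by rewrite -!fP ff.
  apply: subset_leq_card; apply/fintype.subsetP => v /imsetP[j _ ->].
  by rewrite inE; apply/existsP; exists j; rewrite fP.
have site_near p v : p \in bad -> blk p v -> forall m, m != nu p -> beats H (ivec v) (nu p) m.
  move=> /andP[pZ _] /existsP[j /eqP vE] m mn; have [_ hb] := nuP _ pZ.
  have -> : ivec v = ivec p + (ivec j - ivec (off p)) by rewrite vE /base addrAC addrA.
  apply: hb => // i.
  have -> : (ivec j - ivec (off p)) ord0 i = ivec j ord0 i - ivec (off p) ord0 i.
    by rewrite !mxE.
  have := ivec_bound _ j i; have := ivec_bound _ (off p) i.
  by move: (ivec (off p) _ _) (ivec j _ _) => a b; lia.
have baseE p v : blk p v -> base p =
    \row_i (nu p ord0 i + ((ivec v ord0 i - nu p ord0 i) %/ N%:Z)%Z * N%:Z).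
  move=> /existsP[j /eqP vE]; apply/rowP => i; rewrite [RHS]mxE.
  have -> : base p ord0 i = ivec p ord0 i - ivec (off p) ord0 i by rewrite /base !mxE.
  rewrite offE; apply: block_base (ivec_bound _ j i) _.
  by rewrite vE baseDE offE.
have blk_bad v : #|[pred p in bad | blk p v]|%:R <= eta * N%:R ^+ k.
  have [p0 /andP[p0b p0v]|none] := pickP [pred p in bad | blk p v]; last first.
    rewrite eq_card0//; apply: le_trans (Psi0 0) => //.
  have same p : p \in bad -> blk p v -> nu p = nu p0.
    move=> pb pv; apply/eqP; apply: contrapT => /negP nn.
    apply: (@beats_asym _ _ H (ivec v) (nu p) (nu p0)).
      by apply: site_near => //; rewrite eq_sym.
    exact: site_near.
  apply: le_trans (Psi0 (base p0)); rewrite ler_nat.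
  rewrite -(@card_in_imset _ _ off); last first.
    move=> p p' /andP[pb pv] /andP[pb' pv'] oo; apply: ivec_inj.
    have : base p = base p' by rewrite (baseE _ _ pv) (baseE _ _ pv') !same.
    by rewrite /base oo => /addIr.
  apply: subset_leq_card; apply/fintype.subsetP => j /imsetP[p /andP[pb pv] ->].
  rewrite inE; have -> : base p0 = base p.
    by rewrite (baseE _ _ pv) (baseE _ _ p0v) (same _ pb pv).
  have /andP[pZ Gp] := pb.
  rewrite -Gdeep ?addr0//.
    move=> i; have [/(_ i) + _] := nuP _ pZ; rewrite -opprB mxE abszN => h.
    exact: leq_trans h (leq_addr _ _).
  move=> m mn; have [_ hb] := nuP _ pZ.
  by rewrite -[ivec p]addr0; apply: hb => // i; rewrite mxE.
rewrite -(ler_pM2r NR) -natrX -natrM.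
apply: (@le_trans _ _ (\sum_(v : 'rV['I_M]_k) #|[pred p in bad | blk p v]|)%:R).
  rewrite ler_nat -[X in (X * _ <= _)%N]sum1_card big_distrl/=.
  apply: (@leq_trans (\sum_(p in bad) \sum_(v | blk p v) 1)%N).
    by apply: leq_sum => p pb; rewrite mul1n sum1_card; exact: blk_size.
  rewrite (exchange_big_dep xpredT)//=; apply: leq_sum => v _.
  by rewrite sum1_card; apply: subset_leq_card; apply/fintype.subsetP => p; rewrite !inE.
rewrite natr_sum mulrAC; apply: (@le_trans _ _ (\sum_(v : 'rV['I_M]_k) eta * N%:R ^+ k)).
  by apply: ler_sum => v _.
by rewrite sumr_const card_mx card_ord mul1n -[leLHS]mulr_natr natrX natrX mulrC mulrA.
Qed.

(** All positions outside [Z] are counted as zeros; there are at most [M^k - (1 - k/q) M0^k] of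
    them. *)
Lemma zeros_count : (q * M0 ^ k <= q * #|Z| + k * M0 ^ k)%N ->
  q%:R * #|[pred v : 'rV['I_M]_k | G (ivec v) == 0%R]|%:R <=
  q%:R * ((eta + 1) * M%:R ^+ k - M0%:R ^+ k) + k%:R * M0%:R ^+ k.
Proof.
move=> HZ.
have : (#|[pred v : 'rV['I_M]_k | G (ivec v) == 0%R]| + #|Z| <=
    #|[pred v in Z | G (ivec v) == 0%R]| + M ^ k)%N.
  have <- : #|'rV['I_M]_k| = (M ^ k)%N by rewrite card_mx card_ord mul1n.
  rewrite -cardUI addnC leq_add// ?max_card//.
  by apply: subset_leq_card; apply/fintype.subsetP => v; rewrite !inE andbC.
rewrite -(ler_nat R) !natrD natrX => h1.
have := deep_zeros => h2.
have : q%:R * M0%:R ^+ k <= q%:R * #|Z|%:R + k%:R * M0%:R ^+ k :> R.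
  by rewrite -!natrX -!natrM -natrD ler_nat.
have q0 : 0 <= q%:R :> R by [].
have := ler_wpM2l q0 h1; have := ler_wpM2l q0 h2.
rewrite !mulrDr !mulrN !mulrDl !mulrDr; lra.
Qed.

End Count.

Lemma bvec_inj (k K : nat) : injective (@bvec k K).
Proof.
move=> v w vw; apply/rowP => i; apply/val_inj => /=.
have := congr1 (fun u : 'rV[int]_k => u ord0 i) vw; rewrite !mxE => /addIr.
by case.
Qed.

Lemma bernoulli_ineq (R : realType) (u : R) k : 0 <= u <= 1 -> 1 - k%:R * u <= (1 - u) ^+ k.
Proof.
move=> /andP[u0 u1]; elim: k => [|k IH]; first by rewrite expr0 mul0r subr0.
rewrite exprS; apply: (@le_trans _ _ ((1 - u) * (1 - k%:R * u))).
  by have : 0 <= k%:R * u * u by [rewrite !mulr_ge0]; rewrite -natr1; lra.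
by rewrite ler_wpM2l// subr_ge0.
Qed.

(** Bernoulli's inequality for [M = (1 - E/(M+E)) (M+E)]: a border of fixed width is negligible in a
    large cube. *)
Lemma window_ratio (R : realType) (k E : nat) (delta : R) : 0 < delta ->
  exists M1 : nat, forall M, (M1 <= M)%N ->
    (0 < M)%N /\ (1 - delta) * (M + E)%:R ^+ k <= M%:R ^+ k :> R.
Proof.
move=> d0; exists (Num.truncn (k%:R * E%:R / delta)).+1 => M M1M.
have HM : k%:R * E%:R / delta < M%:R.
  by apply: (lt_le_trans (truncnS_gt _)); rewrite ler_nat.
have M0 : (0 < M)%N by exact: leq_ltn_trans M1M.
split=> //.
have M0R : 0 < M%:R :> R by rewrite ltr0n.
have MR : 0 < (M + E)%:R :> R by rewrite natrD ltr_pwDl.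
have -> : M%:R = (1 - E%:R / (M + E)%:R) * (M + E)%:R :> R.
  by rewrite mulrBl mul1r divfK ?gt_eqF// natrD addrK.
rewrite exprMn ler_wpM2r ?exprn_ge0//.
apply: le_trans (bernoulli_ineq _ _); last first.
  by rewrite divr_ge0//= ler_pdivrMr// mul1r natrD lerDr.
rewrite lerD2l lerN2 mulrA ler_pdivrMr//.
rewrite natrD mulrDr; rewrite ltr_pdivrMr// in HM.
by have : 0 <= delta * E%:R by [rewrite mulr_ge0// ltW]; lra.
Qed.

(** * Gluing the blocks along the tiles *)

Definition clamp (R : realType) (t : R) : R := Num.max 0 (Num.min 1 t).

Section Perturbation.
Variables (R : realType) (k : nat) (X : topologicalType) (d : X -> X -> R)
  (T : 'rV[int]_k -> X -> X).
Hypotheses (cX : compact [set: X]) (dm : is_metric_for d) (aT : is_Zk_action T)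
  (mT : marker_property T) (md : mdim_is T d 0).

Lemma clamp_continuous (f : X -> R) : continuous f -> continuous (fun x => clamp (f x)).
Proof.
move=> fc x; apply: (@continuous_max R X (cst 0) (fun x => Num.min 1 (f x))).
  exact: cst_continuous.
by apply: (@continuous_min R X (cst 1) f); [exact: cst_continuous|exact: fc].
Qed.

(** The diagram is seen from the moving point: [cost x m] is the power distance from the origin of
    the orbit of [x] to the site [m]. The weight [al x v] is a continuous substitute for the
    indicator of a tile. It vanishes unless [v] is the strict minimizer in the box, so at most one
    term is active and [g x] lies between [f x] and a single block value. *)
Lemma glue (h : X -> R) (N K : nat) (psi : 'rV['I_N]_k -> X -> R)
    (jn : 'rV[int]_k -> 'rV['I_N]_k) (f : X -> R) (eps : R) :
  continuous h -> continuous f -> (forall v, continuous (psi v)) -> 0 <= eps ->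
  (forall v x, `|psi v x - f (T (ivec v) x)| <= eps) ->
  exists g : X -> R, [/\ continuous g, forall x, `|g x - f x| <= eps &
    forall x p n, in_box K (n - p) ->
     (forall m, m != n -> beats (fun m => h (T m x)) p n m) ->
     g (T p x) = psi (jn (n - p)) (T (p - ivec (jn (n - p))) x)].
Proof.
move=> hc fc pc eps0 pf; have [T0 [TD Tc]] := aT.
pose cost x (m : 'rV[int]_k) : R := sqnorm R m + h (T m x).
pose al x (v : 'rV['I_(K.*2).+1]_k) : R :=
  \prod_(w | w != v) clamp (cost x (bvec w) - cost x (bvec v)).
(* With [j] the offset of [x] in its block, [psi j] is evaluated at [T (- j) x], where it
   approximates [f x] itself. *)
pose src (v : 'rV['I_(K.*2).+1]_k) := - ivec (jn (bvec v)).
pose g x := f x + \sum_v al x v * (psi (jn (bvec v)) (T (src v) x) - f x).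
have clamp01 (t : R) : 0 <= clamp t <= 1.
  by rewrite /clamp le_max lexx/= ge_max ler01/= ge_min lexx.
have al01 x v : 0 <= al x v <= 1.
  apply/andP; split; last by apply: prodr_ile1 => w _; exact: clamp01.
  by apply: prodr_ge0 => w _; have /andP[] := clamp01 (cost x (bvec w) - cost x (bvec v)).
have al_gt x v w : al x v != 0 -> w != v -> cost x (bvec v) < cost x (bvec w).
  move=> /prodf_neq0 H wv; have := H w wv; apply: contra_neqT; rewrite -leNgt => c.
  apply/eqP; rewrite eq_le/= /clamp le_max lexx/= andbT ge_max lexx/= ge_min.
  by rewrite subr_le0 c orbT.
have al_uniq x v w : al x v != 0 -> w != v -> al x w = 0.
  move=> av wv; apply/eqP; apply: contraT => aw.
  have := al_gt x v w av wv; have := al_gt x w v aw; rewrite eq_sym => /(_ wv).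
  by move=> /lt_trans /[apply]; rewrite ltxx.
have g_single x v : al x v != 0 ->
    g x = f x + al x v * (psi (jn (bvec v)) (T (src v) x) - f x).
  move=> av; rewrite /g (bigD1 v)//= big1 ?addr0// => w wv.
  by rewrite (al_uniq _ _ _ av wv) mul0r.
exists g; split.
- have cc m : continuous (fun x => cost x m).
    move=> x; apply: cvgD; first exact: cvg_cst.
    by apply: (@continuous_comp _ _ _ (T m) h); [exact: Tc|exact: hc].
  have alc v : continuous (al^~ v).
    apply: continuous_big; first exact: mul_continuous.
    move=> w _; apply: clamp_continuous => x; apply: cvgB; exact: cc.
  move=> x; apply: cvgD; first exact: fc.
  apply: (@continuous_big R _ +%R 0 xpredT add_continuous X) => v _ {}x.
  apply: cvgM; first exact: alc.
  apply: cvgB; last exact: fc.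
  by apply: (@continuous_comp _ _ _ (T (src v)) (psi _)); [exact: Tc|exact: pc].
- move=> x; have [[v av]|none] := pselect (exists v, al x v != 0); last first.
    rewrite /g big1 ?addr0 ?subrr ?normr0// => v _.
    have -> : al x v = 0 by apply/eqP; apply: contrapT => /negP h0; apply: none; exists v.
    by rewrite mul0r.
  rewrite (g_single _ _ av) addrAC subrr add0r normrM.
  have /andP[a0 a1] := al01 x v; rewrite ger0_norm//.
  have := pf (jn (bvec v)) (T (src v) x); rewrite -TD subrr T0 => h1.
  by apply: le_trans h1; rewrite -[leRHS]mul1r ler_wpM2r.
- move=> x p n nK nb; have [v vE] := in_box_bvec nK.
  have alv : al (T p x) v = 1.
    rewrite /al big1// => w wv.
    (* Site [m] seen from [T p x] is site [m + p] in the coordinates of [x], so [beats] at [p] makes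
       every clamp factor equal to 1. *)
    have costE m : cost (T p x) m = sqnorm R (p - (m + p)) + h (T (m + p) x).
      rewrite /cost TD opprD addrCA subrr addr0; congr (_ + _).
      by apply: eq_bigr => i _; rewrite mxE mulrNz sqrrN.
    have := nb (bvec w + p); rewrite !costE vE subrK /beats => /(_ _) H.
    have {}H : sqnorm R (p - n) + h (T n x) + 1 <=
        sqnorm R (p - (bvec w + p)) + h (T (bvec w + p) x).
      apply: H; apply: contra_neq wv => wn; apply: bvec_inj.
      by rewrite vE -wn addrK.
    by rewrite /clamp min_l ?max_r//; lra.
  rewrite (g_single _ v) ?alv ?oner_eq0// mul1r addrC subrK vE.
  by rewrite -TD /src vE [- ivec _ + p]addrC.
Qed.

(** Zeros in deep blocks ([eta]), positions lost by shrinking ([k/q]) and the border of the window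
    ([M0] against [M]) each cost at most a quarter of [delta]. *)
Lemma perturb (f : X -> R) (eps delta : R) : continuous f -> 0 < eps -> 0 < delta ->
  exists g : X -> R, [/\ continuous g, forall x, `|g x - f x| <= eps &
    exists2 M : nat, (0 < M)%N & forall x,
      #|[pred v : 'rV['I_M]_k | g (T (ivec v) x) == 0%R]|%:R <= delta * M%:R ^+ k].
Proof.
move=> fc eps0 delta0; have [T0 [TD Tc]] := aT.
have eta0 : 0 < delta / 4 by rewrite divr_gt0.
have [N [psi [N0 psic psif psi0]]] := block_functions cX dm aT md fc eps0 eta0.
pose q := (Num.truncn (k%:R / (delta / 4))).+2.
have qk : k%:R <= delta / 4 * q%:R.
  rewrite mulrC -ler_pdivrMr//; apply: ltW; apply: lt_le_trans (truncnS_gt _) _.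
  by rewrite ler_nat.
pose L := (2 * q * (1 + 2 * k * q * N.+1 ^ 2))%N.
have HL : 2 * q%:R * (1 + 2 * k%:R * q%:R * (N.+1)%:R ^+ 2) <= L%:R ^+ 2 :> R.
  have -> : 2 * q%:R * (1 + 2 * k%:R * q%:R * (N.+1)%:R ^+ 2) = L%:R :> R.
    by rewrite /L !(natrM, natrD, natrX).
  by rewrite -natrX ler_nat; nia.
have [phi [D [phic phi01 phi1 phisep]]] := marker_function cX dm aT mT L.
pose reach := (k.+1 * D)%N.
pose B : R := k%:R * D%:R ^+ 2 + k%:R * (reach + N)%:R ^+ 2 + 1.
have B0 : 0 < B by rewrite ltr_wpDl// addr_ge0// mulr_ge0// exprn_ge0.
(* Full markers get height 0 and points with [phi = 0] get height [B], so sites of height below [B]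
   inherit the separation of the markers. *)
pose h x := B * (1 - phi x).
have hc : continuous h.
  by move=> x; apply: cvgM; [exact: cvg_cst|apply: cvgB; [exact: cvg_cst|exact: phic]].
have /choice[jn jnP] : forall n : 'rV[int]_k, exists j : 'rV['I_N]_k,
    ivec j = \row_i ((- n ord0 i) %% N%:Z)%Z.
  move=> n; apply: exists_ivec => i; rewrite mxE modz_ge0 ?ltz_pmod//; lia.
have [g [gc gf gdeep]] := @glue h N (reach + N) psi jn f eps hc fc psic (ltW eps0) psif.
exists g; split=> //.
have [M0 /(_ M0 (leqnn _))[M00 HM]] := @window_ratio R k (reach + N).*2 (delta / 4) eta0.
exists (M0 + (reach + N).*2)%N; first by rewrite addn_gt0 M00.
move=> x; pose H m := h (T m x).
have hB y : h y < B -> 0 < phi y.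
  by rewrite /h -subr_gt0 -{1}[B]mulr1 -mulrBr pmulr_rgt0// opprB addrC subrK.
have H01 m : 0 <= H m <= B.
  have /andP[p0 p1] := phi01 (T m x).
  by rewrite /H /h mulr_ge0 ?(ltW B0) ?subr_ge0//= ler_piMr ?(ltW B0)// lerBlDr lerDl.
have Hsite z : exists2 m, in_box D (z - m) & H m = 0.
  have [n nD pn] := phi1 (T z x); exists (n + z); last first.
    by rewrite /H /h TD pn subrr mulr0.
  by move=> i; rewrite opprD addrCA subrr addr0 mxE abszN.
have Hsep n m : m != n -> H n < B -> H m < B ->
     exists i, (L < `|(m ord0 i - n ord0 i)%R|)%N.
  move=> mn /hB pn /hB pm; apply: contrapT => /forallNP far.
  have := phisep (T n x) (m - n); rewrite -TD subrK subr_eq0 => /(_ mn) E.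
  move: pm; rewrite E ?ltxx// => i.
  by rewrite leqNgt; apply/negP; rewrite !mxE; exact: far.
have [Z [Zc ZP]] := @deep_count R k H q N L D B isT H01 Hsite Hsep HL (lexx _) M0.
have jnE n i : ivec (jn n) ord0 i = ((- n ord0 i) %% N%:Z)%Z by rewrite jnP mxE.
have := @zeros_count R k H q N (delta / 4) jn (fun p => g (T p x))
  (fun j b => psi j (T b x)) _ M0 reach Z N0 jnE (gdeep x) (fun b => psi0 (T b x)) ZP Zc.
set c := #|_|%:R; set u := (_ + _)%:R ^+ k in HM *; set w := M0%:R ^+ k in HM *.
move=> Hc; have q0 : 0 < q%:R :> R by rewrite ltr0n.
have w0 : 0 <= w by rewrite exprn_ge0.
have wu : w <= u by rewrite /w /u lerXn2r ?nnegrE// ler_nat leq_addr.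
rewrite -(ler_pM2l q0); apply: (le_trans Hc).
have h1 : k%:R * w <= q%:R * (delta / 4 * u).
  apply: (@le_trans _ _ (delta / 4 * q%:R * w)); first by rewrite ler_wpM2r.
  by have := ler_wpM2l (ltW q0) (ler_wpM2l (ltW eta0) wu); lra.
apply: (@le_trans _ _ (q%:R * ((delta / 4 + 1) * u - w) + q%:R * (delta / 4 * u))).
  by rewrite lerD2l.
rewrite -mulrDr; apply: (ler_wpM2l (ltW q0)).
have : 0 <= delta * u by apply: (mulr_ge0 (ltW delta0)); exact: le_trans wu.
by move: HM; rewrite !mulrDl mulNr; lra.
Qed.

End Perturbation.

(** * Sparse zero sets are generic *)

(** The condition [0 <= c] covers the empty range, whose [sup] is 0 by convention. *)
Lemma sup_range_le (R : realType) (Y : Type) (u : Y -> R) (c : R) :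
  0 <= c -> (forall y, u y <= c) -> sup (range u) <= c.
Proof.
move=> c0 uc; have [[y _]|Y0] := pselect (exists y : Y, True).
  by apply: ge_sup; [exists (u y), y|move=> _ [z _ <-]].
suff -> : range u = set0 by rewrite sup0.
by apply/seteqP; split => // t [z _ _]; apply: Y0; exists z.
Qed.

Lemma le_sup_range (R : realType) (Y : Type) (u : Y -> R) (c : R) y :
  (forall y, u y <= c) -> u y <= sup (range u).
Proof.
move=> uc; have uu : has_ubound (range u) by exists c => _ [z _ <-].
by apply: (ub_le_sup uu); exists y.
Qed.

Lemma sup_range_ge0 (R : realType) (Y : Type) (u : Y -> R) (c : R) :
  (forall y, 0 <= u y <= c) -> 0 <= sup (range u).
Proof.
move=> uc; have [[y _]|Y0] := pselect (exists y : Y, True).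
  have /andP[u0 _] := uc y; apply: (le_trans u0); apply: (@le_sup_range _ _ _ c) => z.
  by case/andP: (uc z).
suff -> : range u = set0 by rewrite sup0.
by apply/seteqP; split => // t [z _ _]; apply: Y0; exists z.
Qed.

Section Genericity.
Variables (R : realType) (k : nat) (X : topologicalType) (d : X -> X -> R)
  (T : 'rV[int]_k -> X -> X).
Hypotheses (cX : compact [set: X]) (dm : is_metric_for d) (aT : is_Zk_action T).

Definition zeros (f : X -> R) (M : nat) (x : X) : {pred 'rV['I_M]_k} :=
  [pred v | f (T (ivec v) x) == 0].

Arguments zeros : clear implicits.

(** A bound on one cube rather than in the limit, which makes it an open condition; subadditivity
    recovers the limit. *)
Definition sparse_zeros (delta : R) (f : X -> R) : Prop :=
  exists2 M : nat, (0 < M)%N & forall x, #|zeros f M x|%:R <= delta * M%:R ^+ k.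

Lemma orbit_count_zeros f M x : orbit_count R T (f @^-1` [set 0]) M x = #|zeros f M x|%:R.
Proof.
rewrite /orbit_count -sum1_card natr_sum [RHS]big_mkcond; apply: eq_bigr => v _.
rewrite [in RHS]/zeros inE; case: ifPn => [/eqP fv|fv].
  by rewrite mem_set.
by rewrite memNset// => fv0; move: fv; rewrite fv0 eqxx.
Qed.

Lemma sparse_zeros_open delta f : continuous f -> sparse_zeros delta f ->
  exists2 e : R, 0 < e & forall g : X -> R, (forall x, `|g x - f x| < e) ->
    sparse_zeros delta g.
Proof.
move=> fc [M M0 fM]; have [_ [_ Tc]] := aT.
(* Uniform upper semicontinuity: for small [e] the places where [|f| < e] along the orbit of [x] are
   true zeros along the orbit of some [y]. Zeros of [g] at [x] are then zeros of [f] at [y]. *)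
have [||e e0 He] := @compact_uniform R X d cX dm (fun e x =>
    exists y, forall v : 'rV['I_M]_k, `|f (T (ivec v) x)| < e -> f (T (ivec v) y) = 0).
- move=> e e' x e0 ee [y Hy]; exists y => v h; apply: Hy; exact: lt_le_trans ee.
- move=> x.
  have : \forall r \near (0 : R)^'+, forall v : 'rV['I_M]_k, forall x', d x x' < r ->
      `|f (T (ivec v) x')| < r -> f (T (ivec v) x) = 0.
    apply: filter_forall => v.
    have [fv|fv] := eqVneq (f (T (ivec v) x)) 0; first by near=> r.
    have a0 : 0 < `|f (T (ivec v) x)| / 2 by rewrite divr_gt0// normr_gt0.
    have fTc : continuous (f \o T (ivec v)).
      by move=> z; apply: continuous_comp; [exact: Tc|exact: fc].
    have [r r0 Hr] := (metric_continuous dm _).1 fTc x _ a0.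
    near=> s => x' xx' fx'; exfalso.
    have sr : s <= r by near: s; exact: nbhs_right_le.
    have sa : s <= `|f (T (ivec v) x)| / 2 by near: s; exact: nbhs_right_le.
    have /= := Hr _ (lt_le_trans xx' sr).
    have := lerB_dist (f (T (ivec v) x)) (f (T (ivec v) x')); lra.
  move=> /(filterI (nbhs_right_gt 0))/filter_ex[r [/= r0 Hr]].
  by exists r => // x' xx'; exists x => v; exact: Hr.
exists e => // g gf; exists M => // x; have [y Hy] := He x.
apply: le_trans (fM y); rewrite ler_nat; apply: subset_leq_card.
apply/fintype.subsetP => v; rewrite !inE => /eqP gv.
by apply/eqP/Hy; have := gf (T (ivec v) x); rewrite gv sub0r normrN.
Unshelve. all: by end_near. Qed.

(** A cube of side [M] is covered by [(M/N + 1)^k] translates of the good cube of side [N], of total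
    volume at most [(M + N)^k], which is at most [2 M^k] for large [M]. *)
Lemma sparse_zeros_limit delta f : sparse_zeros delta f ->
  exists M1 : nat, forall M, (M1 <= M)%N ->
    (0 < M)%N /\ forall x, #|zeros f M x|%:R <= 2 * delta * M%:R ^+ k.
Proof.
move=> [N N0 fN]; have [T0 [TD _]] := aT.
have half0 : 0 < 1 / 2 :> R by rewrite divr_gt0.
have [M1 HM1] := window_ratio k N half0.
exists M1 => M /HM1[M0 HM]; split=> // x.
pose Q := (M %/ N).+1.
have dvQ (v : 'rV['I_M]_k) i : (v ord0 i %/ N < Q)%N.
  by rewrite ltnS leq_div2r// ltnW.
have mdN (v : 'rV['I_M]_k) i : (v ord0 i %% N < N)%N by rewrite ltn_mod.
pose split_vec (v : 'rV['I_M]_k) : 'rV['I_Q]_k * 'rV['I_N]_k :=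
  (\row_i Ordinal (dvQ v i), \row_i Ordinal (mdN v i)).
pose y (w : 'rV['I_Q]_k) := T (ivec w *+ N) x.
have split_inj : injective split_vec.
  move=> v w [/rowP e1 /rowP e2]; apply/rowP => i; apply/val_inj => /=.
  have := e1 i; have := e2 i; rewrite !mxE => -[h2] [h1].
  by rewrite (divn_eq (v ord0 i) N) h1 h2 -divn_eq.
have splitE v : ivec v = ivec (split_vec v).2 + ivec (split_vec v).1 *+ N.
  apply/rowP => i; rewrite !mxE mulmxnE !mxE /= [in LHS](divn_eq (v ord0 i) N).
  by rewrite PoszD PoszM addrC -mulr_natr natz.
have delta0 : 0 <= delta * N%:R ^+ k by apply: le_trans (fN x).
have : (#|zeros f M x| <= \sum_w #|zeros f N (y w)|)%N.
  rewrite -(card_imset _ split_inj).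
  apply: (@leq_trans #|[pred p : 'rV['I_Q]_k * 'rV['I_N]_k | p.2 \in zeros f N (y p.1)]|).
    apply: subset_leq_card; apply/fintype.subsetP => p /imsetP[v vz ->].
    by move: vz; rewrite !inE /y splitE TD.
  rewrite -sum1_card; under [leqRHS]eq_bigr do rewrite -sum1_card.
  by rewrite pair_big_dep.
rewrite -(ler_nat R) => /le_trans; apply; rewrite natr_sum.
apply: (@le_trans _ _ (\sum_(w : 'rV['I_Q]_k) delta * N%:R ^+ k)).
  by apply: ler_sum => w _.
rewrite sumr_const card_mx card_ord mul1n -[leLHS]mulr_natr natrX -mulrA -exprMn.
have d0 : 0 <= delta by move: delta0; rewrite pmulr_lge0// exprn_gt0// ltr0n.
rewrite [2 * delta]mulrC -mulrA ler_wpM2l//.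
apply: (@le_trans _ _ ((M + N)%:R ^+ k)); last by lra.
rewrite -natrM lerXn2r ?nnegrE// ler_nat /Q mulnS addnC leq_add2r.
by rewrite mulnC leq_divM.
Qed.

Lemma zeros_le f M x : #|zeros f M x|%:R <= M%:R ^+ k :> R.
Proof.
by rewrite -natrX ler_nat (leq_trans (max_card _))// card_mx card_ord mul1n.
Qed.

(** Zero capacity becomes a countable intersection of open conditions; the factor 2 of
    [sparse_zeros_limit] is absorbed by letting [m] grow. *)
Lemma ocap_zeros0 f : ocap_is T (f @^-1` [set 0]) (0 : R) <->
  forall m : nat, sparse_zeros m.+1%:R^-1 f.
Proof.
have cntE N : orbit_count R T (f @^-1` [set 0]) N = fun x => #|zeros f N x|%:R.
  by apply/funext => x; exact: orbit_count_zeros.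
rewrite /ocap_is; under eq_fun do rewrite cntE.
split=> [/cvgrPdist_lt H m|H].
  have m0 : 0 < m.+1%:R^-1 :> R by rewrite invr_gt0.
  have [N [N0 HN]] := filter_ex (filterI (nbhs_infty_gt 0) (H _ m0)).
  exists N => // x.
  have NR : 0 < N%:R ^+ k :> R by rewrite exprn_gt0// ltr0n.
  apply: (le_trans (@le_sup_range _ _ (fun x => #|zeros f N x|%:R) (N%:R ^+ k) x _)).
    by move=> z; exact: zeros_le.
  move: HN; rewrite /= sub0r normrN => /ltW/(le_trans (ler_norm _)).
  by rewrite mulrC ler_pdivrMr.
apply/cvgrPdist_lt => e e0.
have [m me] : exists m : nat, 2 * m.+1%:R^-1 < e.
  exists (Num.truncn (2 / e)); rewrite ltr_pdivrMr// mulrC -ltr_pdivrMr//.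
  exact: truncnS_gt.
have [M1 HM1] := sparse_zeros_limit (H m).
near=> M.
have /HM1[M0 HM] : (M1 <= M)%N by near: M; exact: nbhs_infty_ge.
have MR : 0 < M%:R ^+ k :> R by rewrite exprn_gt0// ltr0n.
rewrite sub0r normrN ger0_norm; last first.
  apply: mulr_ge0; first by rewrite invr_ge0 ltW.
  by apply: (@sup_range_ge0 _ _ _ (M%:R ^+ k)) => x; rewrite ler0n zeros_le.
apply: le_lt_trans me; rewrite mulrC ler_pdivrMr//.
by apply: sup_range_le => //; rewrite !mulr_ge0// ltW.
Unshelve. all: by end_near. Qed.

(** Compactness bounds [|f - g|], so that [sup] is a true upper bound and not a default value. *)
Lemma supdist_lt (f g : X -> R) (e : R) : continuous f -> continuous g ->
  supdist f g < e -> forall x, `|f x - g x| < e.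
Proof.
move=> fc gc fg x.
have [F HF] := continuous_bounded cX dm fc; have [G HG] := continuous_bounded cX dm gc.
apply: le_lt_trans fg; apply: (@le_sup_range _ _ (fun x => `|f x - g x|) (F + G)) => y.
by apply: le_trans (ler_normB _ _) _; exact: lerD.
Qed.

(* The limit is squeezed between the nested intervals [f_i - e_i, f_i + e_i]. *)
Lemma nested_limit (F : nat -> X -> R) (e : nat -> R) :
  (forall i, continuous (F i)) -> (forall i, 0 < e i) ->
  (forall i, e i.+1 <= e i / 2) ->
  (forall i x, `|F i.+1 x - F i x| <= e i / 2) ->
  exists2 g : X -> R, continuous g & forall i x, `|g x - F i x| <= e i.
Proof.
move=> Fc e0 eh Fh.
have tail i n x : `|F (i + n)%N x - F i x| + e (i + n)%N <= e i.
  elim: n => [|n IH]; first by rewrite addn0 subrr normr0 add0r.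
  rewrite addnS; have := Fh (i + n)%N x; have := eh (i + n)%N.
  have := ler_distD (F (i + n)%N x) (F (i + n).+1 x) (F i x); lra.
have cross i j x : F j x - e j <= F i x + e i.
  have [ij|/ltnW ji] := leqP i j.
    have := tail i (j - i)%N x; rewrite subnKC// => h.
    by have := ler_norm (F j x - F i x); have := e0 j; lra.
  have := tail j (i - j)%N x; rewrite subnKC// => h.
  by have := ler_norm (F j x - F i x); rewrite distrC; have := e0 i; lra.
pose g x := sup (range (fun i => F i x - e i)).
have gF i x : `|g x - F i x| <= e i.
  have : F i x - e i <= g x.
    by apply: (@le_sup_range _ _ (fun i => F i x - e i) (F 0%N x + e 0%N)) => j; exact: cross.
  have : g x <= F i x + e i.
    by apply: ge_sup; [exists (F 0%N x - e 0%N), 0%N|move=> _ [j _ <-]; exact: cross].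
  by move=> *; rewrite ler_norml; apply/andP; split; lra.
exists g => // x; apply/cvgrPdist_lt => a a0.
have ei i : e i * i.+1%:R <= e 0%N.
  elim: i => [|i IH]; first by rewrite mulr1.
  apply: le_trans IH; apply: (le_trans (ler_wpM2r (ler0n R i.+2) (eh i))).
  rewrite -mulrA ler_pM2l//.
  have -> : i.+2%:R = i%:R + 2 :> R by rewrite -addn2 natrD.
  have -> : i.+1%:R = i%:R + 1 :> R by rewrite -addn1 natrD.
  by have := ler0n R i; lra.
have [i ia] : exists i, e i < a / 3.
  exists (Num.truncn (e 0%N / (a / 3))).
  have a3 : 0 < a / 3 by rewrite divr_gt0.
  have := ei (Num.truncn (e 0%N / (a / 3))).
  have := truncnS_gt (e 0%N / (a / 3)); rewrite ltr_pdivrMr// => h1 h2.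
  by have := le_lt_trans h2 h1; rewrite mulrC ltr_pM2l.
have a3 : 0 < a / 3 by rewrite divr_gt0.
have := Fc i x; move/cvgrPdist_lt => /(_ _ a3); apply: filterS => y.
have := gF i x; have := gF i y; rewrite !ler_norml !ltr_norml.
by move=> /andP[? ?] /andP[? ?] /andP[? ?]; apply/andP; split; lra.
Qed.

(** Baire's argument by hand: stage [i] perturbs by at most half the current radius, then picks a
    closed ball inside the previous one on which condition [i] holds. The limit lies in all the
    balls. *)
Lemma sparse_zeros_dense : marker_property T -> mdim_is T d 0 ->
  forall (f : X -> R) (e : R), continuous f -> 0 < e ->
  exists g : X -> R, [/\ continuous g, forall m : nat, sparse_zeros m.+1%:R^-1 g &
    forall x, `|g x - f x| <= e].
Proof.
move=> mT md f e fc e0.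
have step (p : nat * ((X -> R) * R)) : exists p' : (X -> R) * R,
    continuous p.2.1 -> 0 < p.2.2 ->
    [/\ continuous p'.1, 0 < p'.2, p'.2 <= p.2.2 / 2,
      forall x, `|p'.1 x - p.2.1 x| <= p.2.2 / 2 &
      forall g : X -> R, (forall x, `|g x - p'.1 x| <= p'.2) -> sparse_zeros p.1.+1%:R^-1 g].
  case: p => i [h a] /=.
  have [[hc a0]|no] := pselect (continuous h /\ 0 < a); last first.
    by exists (h, a) => hc a0; exfalso; apply: no.
  have a2 : 0 < a / 2 by rewrite divr_gt0.
  have i0 : 0 < i.+1%:R^-1 :> R by rewrite invr_gt0.
  have [g [gc gh gs]] := perturb cX dm aT mT md hc a2 i0.
  have [b b0 Hb] := sparse_zeros_open gc gs.
  (* Halving [b] fits a closed ball into the open ball of stability; [a / 2] keeps the balls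
     nested. *)
  exists (g, Num.min (a / 2) (b / 2)) => _ _ /=; split=> //.
  - by rewrite lt_min a2 divr_gt0.
  - by rewrite ge_min lexx.
  - move=> g' gg'; apply: Hb => x; apply: le_lt_trans (gg' x) _.
    by rewrite gt_min; apply/orP; right; lra.
have [st stP] := choice step.
pose s := fix s i := if i is j.+1 then st (j, s j) else (f, e).
have sP i : continuous (s i).1 /\ 0 < (s i).2.
  by elim: i => [//|i [IH1 IH2]]; have [] := stP (i, s i) IH1 IH2.
have sS i := stP (i, s i) (sP i).1 (sP i).2.
have [||||g gc gs] := @nested_limit (fun i => (s i).1) (fun i => (s i).2).
- by move=> i; case: (sP i).
- by move=> i; case: (sP i).
- by move=> i; case: (sS i).
- by move=> i; case: (sS i).
- exists g; split=> // [m|x]; last exact: (gs 0%N).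
  by have [_ _ _ _] := sS m; apply; exact: (gs m.+1).
Qed.

End Genericity.

Theorem theorem5p3 (R : realType) (k : nat) (X : topologicalType)
    (d : X -> X -> R) (T : 'rV[int]_k -> X -> X) :
  compact [set: X] -> is_metric_for d -> is_Zk_action T ->
  marker_property T -> mdim_is T d 0 ->
  let G := [set f : X -> R | continuous f /\ ocap_is T (f @^-1` [set 0]) (0 : R)] in
  C_dense G /\ C_Gdelta G.
Proof.
move=> cX dm aT mT md G; split.
  (* A pointwise bound passes to the supremum only as a weak inequality, hence [e / 2]. *)
  move=> f fc e e0; have e2 : 0 < e / 2 by rewrite divr_gt0.
  have [g [gc gs gf]] := sparse_zeros_dense cX dm aT mT md fc e2.
  exists g; split=> //; first by split=> //; exact/ocap_zeros0.
  apply: (@le_lt_trans _ _ (e / 2)); last by rewrite ltr_pdivrMr// ltr_pMr// ltr1n.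
  by apply: sup_range_le => [|x]; [exact: ltW|rewrite distrC].
exists (fun m => sparse_zeros T m.+1%:R^-1); split=> [m f fc fs|f fc].
  have [e e0 He] := sparse_zeros_open cX dm aT fc fs.
  exists e => // g gc fg; apply: He => x; rewrite distrC.
  exact: (supdist_lt cX dm fc gc fg).
by split=> [[_ /(ocap_zeros0 aT)]|/(ocap_zeros0 aT)].
Qed.
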